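(* Let $n\ge2$. There exists divergence-free $u\in\mathcal S(\mathbb R^n;\mathbb R^n)$ such that the associated pressure $p=\sum_{l,k=1}^n(-\Delta)^{-1}\partial_l\partial_k(u_lu_k)$ satisfies $p\notin L^1(\mathbb R^n)$.
   Context: $\mathcal S$ denotes Schwartz functions; divergence-free means $\sum_k\partial_ku_k=0$. $(-\Delta)^{-1}\partial_l\partial_k$ is the Fourier multiplier with symbol $-\xi_l\xi_k/|\xi|^2$, so $-\Delta p=\sum_{k,l}\partial_k\partial_l(u_ku_l)$. *)

(* Defs.v *)
From HB Require Import structures.
From mathcomp Require Import all_boot all_order all_algebra.
From mathcomp Require Import all_classical all_reals all_analysis.
From mathcomp Require Import complex.

Set Implicit Arguments.
Unset Strict Implicit.
Unset Printing Implicit Defensive.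

Import Order.TTheory GRing.Theory Num.Theory.
Import numFieldNormedType.Exports.

Local Open Scope classical_set_scope.
Local Open Scope ring_scope.
Local Open Scope complex_scope.

Definition rV_display : measure_display.
Proof. exact: default_measure_display. Qed.

Section measurable_rV.
Context {R : realType} {n : nat}.

Definition rV_coord (i : 'I_n) (x : 'rV[R]_n) : measurableTypeR R := x 0 i.

Let rV_set0 : g_sigma_preimage rV_coord set0.
Proof. exact: sigma_algebra0. Qed.

Let rV_setC A : g_sigma_preimage rV_coord A -> g_sigma_preimage rV_coord (~` A).
Proof. exact: sigma_algebraC. Qed.

Let rV_bigcup (F : _^nat) : (forall i, g_sigma_preimage rV_coord (F i)) ->
  g_sigma_preimage rV_coord (\bigcup_i (F i)).
Proof. exact: sigma_algebra_bigcup. Qed.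

(* The sigma-algebra generated by the coordinates, i.e. the Borel one. *)
HB.instance Definition _ := @isMeasurable.Build rV_display
  'rV[R]_n (g_sigma_preimage rV_coord) rV_set0 rV_setC rV_bigcup.

Lemma measurable_rV_coord (i : 'I_n) : measurable_fun [set: 'rV[R]_n] (rV_coord i).
Proof.
move=> _ Y mY; rewrite setTI; apply: sub_sigma_algebra => /=.
rewrite -bigcup_seq/=; exists i => /=; first by rewrite mem_index_enum.
by exists Y => //; rewrite setTI.
Qed.

Lemma measurable_fun_rVP d (T : measurableType d) (f : T -> 'rV[R]_n) :
  measurable_fun [set: T] f <->
  forall i, measurable_fun [set: T] (rV_coord i \o f).
Proof.
split=> [mf i|mf].
  by apply: measurableT_comp => //; exact: measurable_rV_coord.
suff prefS : g_sigma_preimage (fun i => rV_coord i \o f) `<=` measurable.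
  move=> _ A mA; apply: prefS.
  rewrite (@g_sigma_preimage_comp _ _ _ 'rV[R]_n rV_coord _ f).
  by exists A.
apply: smallest_sub; first exact: sigma_algebra_measurable.
move=> A; rewrite -bigcup_seq => -[i _ [B mB <-]]; exact: mf.
Qed.

End measurable_rV.

Section lebesgue_rV.
Context {R : realType}.

Definition rV_cons {n} (p : measurableTypeR R * 'rV[R]_n) : 'rV[R]_n.+1 :=
  row_mx (p.1)%:M p.2.

Lemma rV_cons0 n (p : measurableTypeR R * 'rV[R]_n) : rV_cons p 0 0 = p.1.
Proof.
transitivity (row_mx (p.1)%:M p.2 0 (lshift n (0 : 'I_1))).
  by congr (row_mx _ _ _ _); exact/val_inj.
by rewrite row_mxEl mxE eqxx.
Qed.

Lemma rV_consS n (p : measurableTypeR R * 'rV[R]_n) (i : 'I_n) :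
  rV_cons p 0 (lift ord0 i) = p.2 0 i.
Proof.
transitivity (row_mx (p.1)%:M p.2 0 (rshift 1 i)).
  by congr (row_mx _ _ _ _); exact/val_inj.
by rewrite row_mxEr.
Qed.

Lemma measurable_rV_cons n :
  measurable_fun [set: measurableTypeR R * 'rV[R]_n] (@rV_cons n).
Proof.
apply/measurable_fun_rVP => i; case: (unliftP ord0 i) => [j|] ->.
  rewrite (_ : _ \o _ = rV_coord j \o snd); last first.
    by apply/funext => p; exact: rV_consS.
  by apply: measurableT_comp => //; exact: measurable_rV_coord.
rewrite (_ : _ \o _ = fst) //; by apply/funext => p; exact: rV_cons0.
Qed.

Lemma measurable_rV_uncons n : measurable_fun [set: 'rV[R]_n.+1]
  (fun v => (rV_coord 0 v, (\row_j v 0 (lift ord0 j) : 'rV[R]_n))).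
Proof.
apply: measurable_fun_pair; first exact: measurable_rV_coord.
apply/measurable_fun_rVP => i.
rewrite (_ : _ \o _ = rV_coord (lift ord0 i)); first exact: measurable_rV_coord.
by apply/funext => v; rewrite /rV_coord /= mxE.
Qed.

Definition lebesgue_rV_step {n} (mu : {sigma_finite_measure set 'rV[R]_n -> \bar R})
    : set 'rV[R]_n.+1 -> \bar R :=
  pushforward (@lebesgue_measure R \x mu)%E (@rV_cons n).

Section step.
Context {n : nat} (mu : {sigma_finite_measure set 'rV[R]_n -> \bar R}).

HB.instance Definition _ := Measure.copy (lebesgue_rV_step mu)
  (@measure_function_pushforward__canonical__measure_function_Measure
     _ _ _ _ R (@lebesgue_measure R \x mu)%E _ (@measurable_rV_cons n)).

(* The canonical sigma-finite structure on products only resolves for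
   subprobabilities, so sigma-finiteness of the product is shown directly. *)
Let step_sigma_finite : sigma_finite setT (lebesgue_rV_step mu).
Proof.
have [F [FT mF]] : exists F : (set (measurableTypeR R * 'rV[R]_n))^nat,
    setT = \bigcup_k F k /\
    forall k, measurable (F k) /\ ((@lebesgue_measure R \x mu)%E (F k) < +oo)%E.
  have /sigma_finiteP[F [TF ndF Foo]] := sigma_finiteT (@lebesgue_measure R).
  have /sigma_finiteP[G [TG ndG Goo]] := sigma_finiteT mu.
  exists (fun k => F k `*` G k); split.
    rewrite -setXTT TF TG predeqE => -[x y]; split.
      move=> [/= [k _ Fkx] [l _ Gly]]; exists (maxn k l) => //; split.
      - by move: x Fkx; exact/subsetPset/ndF/leq_maxl.
      - by move: y Gly; exact/subsetPset/ndG/leq_maxr.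
    by move=> [k _ []/= ? ?]; split; exists k.
  move=> k; have [? ?] := Foo k; have [? ?] := Goo k.
  split; first exact: measurableX.
  by rewrite product_measure1E// lte_mul_pinfty// ge0_fin_numE.
pose psi (v : 'rV[R]_n.+1) := (rV_coord 0 v, (\row_j v 0 (lift ord0 j) : 'rV[R]_n)).
exists (fun k => psi @^-1` F k).
  by rewrite -preimage_bigcup -FT preimage_setT.
move=> k; have [mFk Fk] := mF k; split.
  by rewrite -[X in measurable X]setTI; exact: measurable_rV_uncons.
rewrite /lebesgue_rV_step /pushforward -comp_preimage.
rewrite (_ : psi \o _ = id)//.
apply/funext => -[x v]; rewrite /psi /= /rV_coord rV_cons0; congr pair.
by apply/rowP => j; rewrite mxE rV_consS.
Qed.

HB.instance Definition _ :=
  Measure_isSigmaFinite.Build _ _ _ (lebesgue_rV_step mu) step_sigma_finite.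

End step.

Fixpoint lebesgue_rV n : {sigma_finite_measure set 'rV[R]_n -> \bar R} :=
  match n with
  | 0 => \d_(0 : 'rV[R]_0)
  | n'.+1 => lebesgue_rV_step (lebesgue_rV n')
  end.

Lemma measurable_rV_box n (A : 'I_n -> set (measurableTypeR R)) :
  (forall i, measurable (A i)) ->
  measurable ([set v | forall i, A i (v 0 i)] : set 'rV[R]_n).
Proof.
move=> mA; set B := (B in measurable B).
have -> : B = \big[setI/setT]_(i < n) (rV_coord i @^-1` A i).
  rewrite -bigcap_seq; apply/seteqP; split=> v /= Av i; first by move=> _; exact: Av.
  by apply: (Av i); rewrite /= mem_index_enum.
apply: bigsetI_measurable => i _; rewrite -[X in measurable X]setTI.
exact: measurable_rV_coord.
Qed.

Lemma lebesgue_rV_box n (A : 'I_n -> set (measurableTypeR R)) :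
  (forall i, measurable (A i)) ->
  lebesgue_rV n ([set v | forall i, A i (v 0 i)] : set 'rV[R]_n) =
    (\prod_(i < n) lebesgue_measure (A i))%E.
Proof.
elim: n A => [|n IH] A mA.
  rewrite big_ord0 /= diracE mem_set //; by case.
rewrite big_ord_recl -IH // -product_measure1E //; last first.
  exact: (@measurable_rV_box n (fun i => A (lift ord0 i))).
congr (product_measure1 _ _ _); apply/seteqP; split=> [[x v] /= Av|[x v] /= [Ax Av] i].
  split=> [|i]; first by have := Av ord0; rewrite rV_cons0.
  by have := Av (lift ord0 i); rewrite rV_consS.
by case: (unliftP ord0 i) => [j|] ->; rewrite ?rV_consS ?rV_cons0.
Qed.

End lebesgue_rV.

Section calculus.
Context {R : realType} {n : nat}.
Implicit Types (f : 'rV[R]_n -> R) (u : 'rV[R]_n -> 'rV[R]_n).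

Definition partial (i : 'I_n) f : 'rV[R]_n -> R :=
  fun x => 'D_(delta_mx 0 i) f x.

(* partials [:: i_1; ...; i_m] f = d_{i_1} ... d_{i_m} f *)
Definition partials (s : seq 'I_n) f : 'rV[R]_n -> R := foldr partial f s.

(* Differentiability of every iterated partial derivative makes all of them
   continuous, so this is C^infinity. *)
Definition smooth f := forall s x, differentiable (partials s f) x.

Definition monomial (a : 'I_n -> nat) (x : 'rV[R]_n) : R :=
  \prod_(i < n) x 0 i ^+ a i.

Definition schwartz f := smooth f /\
  forall (a : 'I_n -> nat) (s : seq 'I_n),
    exists M : R, forall x, `|monomial a x * partials s f x| <= M.

Definition schwartz_field u := forall i : 'I_n, schwartz (fun x => u x 0 i).

Definition divergence u (x : 'rV[R]_n) : R :=
  \sum_(k < n) partial k (fun y => u y 0 k) x.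

Definition divergence_free u := forall x, divergence u x = 0.

End calculus.

Section fourier.
Context {R : realType} {n : nat}.
Implicit Types f g : 'rV[R]_n -> R[i].

Definition dotv (x y : 'rV[R]_n) : R := \sum_(i < n) x 0 i * y 0 i.

Definition expi (t : R) : R[i] := cos t +i* sin t.

(* A complex function is in L^1 iff its real and imaginary parts are. *)
Definition inL1 f :=
  (lebesgue_rV n).-integrable setT (fun x => (complex.Re (f x))%:E) /\
  (lebesgue_rV n).-integrable setT (fun x => (complex.Im (f x))%:E).

Definition cintegral f : R[i] :=
  (\int[lebesgue_rV n]_x complex.Re (f x)) +i* (\int[lebesgue_rV n]_x complex.Im (f x)).

Definition fourier f (xi : 'rV[R]_n) : R[i] :=
  cintegral (fun x => f x * expi (- (2 * pi * dotv x xi))).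

Definition inv_fourier g (x : 'rV[R]_n) : R[i] :=
  cintegral (fun xi => g xi * expi (2 * pi * dotv x xi)).

(* The integrals converge absolutely as soon as f is Schwartz and the symbol m
   is bounded and measurable, which is the only case used below. *)
Definition fourier_multiplier (m : 'rV[R]_n -> R) f : 'rV[R]_n -> R[i] :=
  inv_fourier (fun xi => (m xi)%:C * fourier f xi).

(* The symbol of (-Delta)^-1 d_l d_k. It is homogeneous of degree 0, so the
   factor 2 pi in the exponent of the Fourier transform does not enter; its value
   at the origin is 0 / 0 = 0, on a null set. *)
Definition riesz_symbol (l k : 'I_n) (xi : 'rV[R]_n) : R :=
  - (xi 0 l * xi 0 k / dotv xi xi).

(* An absolutely convergent inverse Fourier integral for Schwartz u: a function
   defined everywhere, the continuous representative of its a.e. class. It is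
   real-valued in that case, but the inversion formula yields it in R[i]. *)
Definition pressure (u : 'rV[R]_n -> 'rV[R]_n) (x : 'rV[R]_n) : R[i] :=
  \sum_(l < n) \sum_(k < n)
    fourier_multiplier (riesz_symbol l k) (fun y => (u y 0 l * u y 0 k)%:C) x.

End fourier.

(* Main.v *)
Require Import Defs.
From HB Require Import structures.
From mathcomp Require Import all_boot all_order all_algebra.
From mathcomp Require Import all_classical all_reals all_analysis.
From mathcomp Require Import complex.
From mathcomp Require Import measurable_realfun perm ring lra.

(** If [p] were integrable, its Fourier transform would be continuous at the
    origin, where it behaves like [- sum_(l, k) xi_l xi_k A_lk / |xi|^2] with
    [A_lk] the integral of [u_l u_k]; this forces [A] to be a multiple of the
    identity. For the anisotropic Gaussian field
    [u = (x_1 E, - 2 x_0 E, 0, ..., 0)], [E = exp (- (pi / 2) (2 x_0^2 + x_1^2 + ...))],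
    the entries [A_00] and [A_11] differ.

    Here the transform of [u_l u_k] is explicit, and the quartic terms of the
    symbol cancel, so that [p] is the inverse transform of
    [- gaussian * (sum_i b_i xi_i^2) / |xi|^2] with [b_0 <> b_1]. Continuity of the
    transform of [p] is replaced by testing [p] against wide Gaussians: by Fubini,
    [int p(x) exp (- pi |S x|^2) dx] is the mean of the symbol at [S eta] for a
    Gaussian [eta], with [S] diagonal. Letting [S] tend to 0, the left-hand side
    tends to the integral of [p]; if the [j]-th entry of [S] is [t] and the others
    are [t^2], the right-hand side tends to [- b_j]. Hence [b_j] cannot depend on
    [j] when [p] is integrable. *)

Set Implicit Arguments.
Unset Strict Implicit.
Unset Printing Implicit Defensive.

Import Order.TTheory GRing.Theory Num.Theory.
Import numFieldNormedType.Exports.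

Local Open Scope classical_set_scope.
Local Open Scope ring_scope.

(** * Gaussian integrals on the line *)

Section real_integrable.
Context d (T : measurableType d) {R : realType} (mu : {measure set T -> \bar R}).
Implicit Types f g : T -> R.
Local Notation integ f := (mu.-integrable setT (EFin \o f)).

Lemma integrableR_sub f g : integ f -> integ g -> integ (fun x => f x - g x).
Proof. exact: integrableB. Qed.

Lemma integrableR_scale (c : R) f : integ f -> integ (fun x => c * f x).
Proof. exact: integrableZl. Qed.

Lemma integrableR_measurable f : integ f -> measurable_fun setT f.
Proof. by move=> fi; apply/measurable_EFinP; apply: measurable_int fi. Qed.

Lemma integrableR_bounded f g (M : R) : integ f -> measurable_fun setT g ->
  (forall x, `|g x| <= M) -> integ (fun x => f x * g x).
Proof.
move=> fi mg gM; apply: (le_integrable _ _ _ (integrableR_scale M fi)) => //.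
  by apply/measurable_EFinP/measurable_funM => //; exact: integrableR_measurable.
move=> x _; rewrite lee_fin normrM [leRHS]normrM mulrC ler_wpM2r//.
exact: le_trans (gM x) (ler_norm _).
Qed.

End real_integrable.

Lemma norm_cos_le1 (R : realType) (x : R) : `|cos x| <= 1.
Proof. by rewrite ler_norml cos_geN1 cos_le1. Qed.

Section gauss1.
Context {R : realType}.
Implicit Types (a b x y w th : R) (f g : R -> R).
Local Notation mu := (@lebesgue_measure R).
Local Notation integ f := (mu.-integrable setT (EFin \o f)).

(** The factor [pi] matches the [2 pi] in the exponent of [fourier]: the transform of [gauss a] is
    [(Num.sqrt a)^-1 * gauss a^-1]. *)
Definition gauss a x : R := expR (- (pi * a * x ^+ 2)).

Lemma gauss_gt0 a x : 0 < gauss a x. Proof. exact: expR_gt0. Qed.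

Lemma gauss_le1 a x : 0 <= a -> gauss a x <= 1.
Proof.
move=> a0; rewrite -expR0 ler_expR oppr_le0.
by rewrite mulr_ge0 ?sqr_ge0// mulr_ge0 ?pi_ge0.
Qed.

Lemma gaussD a b x : gauss (a + b) x = gauss a x * gauss b x.
Proof. by rewrite -expRD; congr expR; ring. Qed.

Lemma gauss0 a : gauss a 0 = 1.
Proof. by rewrite /gauss expr0n mulr0 oppr0 expR0. Qed.

Lemma is_derive_gauss a x :
  is_derive x 1 (gauss a) (- (2 * pi * a) * (x * gauss a x)).
Proof.
rewrite /gauss; apply: is_derive_eq.
by rewrite /GRing.scale /= !mulr1; ring.
Qed.

Lemma continuous_gauss a : continuous (gauss a).
Proof.
move=> x; apply/differentiable_continuous/derivable1_diffP.
by have [] := is_derive_gauss a x.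
Qed.

Lemma measurable_gauss a : measurable_fun setT (gauss a).
Proof. apply: continuous_measurable_fun; exact: continuous_gauss. Qed.

(** The normal density has total mass 1, so matching the variance [1 / (2 pi a)] gives access to the
    Gaussian integral. *)
Lemma gauss_normal a : 0 < a ->
  gauss a = normal_fun 0 (Num.sqrt (2 * pi * a)^-1).
Proof.
move=> a0; apply/funext => x; rewrite /gauss /normal_fun subr0.
have p0 := pi_gt0 R; have ne : 2 * pi * a != 0 :> R by rewrite !mulf_neq0 ?gt_eqF.
rewrite sqr_sqrtr ?invr_ge0 ?mulr_ge0 ?ltW//; congr expR.
by rewrite -mulr_natr; move: (pi : R) p0 {ne} => p p0; field; rewrite ?gt_eqF.
Qed.

Lemma integral_gauss a : 0 < a ->
  (\int[mu]_x (gauss a x)%:E)%E = ((Num.sqrt a)^-1)%:E.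
Proof.
move=> a0; have p0 := pi_gt0 R.
pose s : R := Num.sqrt (2 * pi * a)^-1.
have s0 : s != 0 by rewrite gt_eqF// sqrtr_gt0 invr_gt0 !mulr_gt0.
have := integral_normal_pdf 0 s; rewrite normal_pdfE//.
under eq_integral do rewrite EFinM.
rewrite -gauss_normal// ge0_integralZl//=; first last.
- by rewrite lee_fin normal_peak_ge0.
- by move=> x _; rewrite lee_fin ltW// gauss_gt0.
- by apply/measurable_EFinP; exact: measurable_gauss.
move=> h.
have pk : normal_peak s = Num.sqrt a.
  rewrite /normal_peak /s sqr_sqrtr ?invr_ge0 ?mulr_ge0 ?ltW//.
  rewrite -sqrtrV ?mulrn_wge0 ?mulr_ge0 ?invr_ge0 ?mulr_ge0 ?ltW//.
  by congr Num.sqrt; rewrite -mulr_natr; move: (pi : R) p0 => p p0; field; rewrite ?gt_eqF.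
move: h; rewrite pk => h.
have : (((Num.sqrt a)^-1)%:E * ((Num.sqrt a)%:E *
   \int[mu]_x (gauss a x)%:E) = ((Num.sqrt a)^-1)%:E)%E by rewrite h mule1.
by rewrite muleA -EFinM mulVf ?mul1e// gt_eqF// sqrtr_gt0.
Qed.

Lemma integrable_gauss a : 0 < a -> integ (gauss a).
Proof.
move=> a0; apply/integrableP; split; first by apply/measurable_EFinP; exact: measurable_gauss.
under eq_integral do rewrite /= ger0_norm ?(ltW (gauss_gt0 _ _))//.
by rewrite integral_gauss// ltry.
Qed.

Lemma norm_gauss_bound a : 0 < a ->
  exists M : R, forall x, `|x| * gauss a x <= M.
Proof.
move=> a0; have p0 := pi_gt0 R.
(* From [y * expR (- y) <= 1] at [y = pi a x ^ 2] comes [x ^ 2 * gauss a x <= (pi a)^-1]; then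
   [|x| <= 1 + x ^ 2] and [gauss a x <= 1] give this constant. *)
exists (1 + (pi * a)^-1) => x.
have h : pi * a * x ^+ 2 * gauss a x <= 1.
  have := expR_ge1Dx (pi * a * x ^+ 2).
  have := gauss_gt0 a x; rewrite /gauss expRN; set e := expR _ => e0 he.
  rewrite ler_pdivrMr ?mul1r ?expR_gt0//; lra.
have h2 : x ^+ 2 * gauss a x <= (pi * a)^-1.
  by rewrite -[leRHS]mulr1 ler_pdivlMl ?mulr_gt0// mulrA.
have h1 := @gauss_le1 a x (ltW a0).
have h0 := gauss_gt0 a x.
have : `|x| <= 1 + x ^+ 2.
  rewrite -real_normK ?num_real//; have := normr_ge0 x; nra.
move=> hx; apply: (@le_trans _ _ ((1 + x ^+ 2) * gauss a x)).
  by rewrite ler_pM2r.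
lra.
Qed.

(** Each power of [x] is paid for by half of the remaining decay: [gauss a] splits into two copies
    of [gauss (a / 2)], one for the new factor [x] and one for [x ^ k]. *)
Lemma monom_gauss_bound (k : nat) a : 0 < a ->
  exists M : R, forall x, `|x ^+ k * gauss a x| <= M.
Proof.
elim: k a => [|k IH] a a0.
  exists 1 => x; rewrite expr0 mul1r ger0_norm ?(ltW (gauss_gt0 _ _))//.
  exact/gauss_le1/ltW.
have a20 : 0 < a / 2 by rewrite divr_gt0.
have [M1 h1] := IH _ a20; have [M2 h2] := norm_gauss_bound a20.
exists (M2 * M1) => x.
rewrite [in gauss _](splitr a) gaussD exprS mulrACA normrM ler_pM ?normr_ge0//.
by rewrite normrM (ger0_norm (ltW (gauss_gt0 _ _))).
Qed.

Lemma integrable_monom_gauss (k : nat) a : 0 < a ->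
  integ (fun x => x ^+ k * gauss a x).
Proof.
move=> a0; have a20 : 0 < a / 2 by rewrite divr_gt0.
have [M hM] := monom_gauss_bound k a20.
have gi : mu.-integrable setT (fun x => M%:E * (gauss (a / 2) x)%:E)%E.
  by apply: integrableZl => //; exact: integrable_gauss.
apply: le_integrable gi => //.
- apply/measurable_EFinP; apply: measurable_funM; last exact: measurable_gauss.
  exact: measurable_funX.
- move=> x _; rewrite -EFinM /= lee_fin.
  rewrite [in gauss _](splitr a) gaussD mulrA normrM [leRHS]normrM ler_wpM2r//.
  exact: le_trans (hM x) (ler_norm _).
Qed.

Lemma integrable_mul_cos f w th : integ f -> integ (fun x => f x * cos (w * x - th)).
Proof.
move=> fi; apply: (integrableR_bounded fi _ (M := 1)) => [|x]; last exact: norm_cos_le1.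
apply: continuous_measurable_fun => x.
apply: continuous_comp; last exact: continuous_cos.
by apply: continuousB; [apply: continuousM; [exact: cvg_cst|exact: cvg_id]|exact: cvg_cst].
Qed.

(** The fundamental theorem on [[- k.+1, k.+1]] leaves boundary terms, which are at most
    [2 M / k.+1] because [x * f x] is bounded; dominated convergence passes to the whole line. *)
Lemma Rintegral_derive_eq0 f f' :
  (forall x, is_derive x 1 f (f' x)) -> continuous f' -> integ f' ->
  (exists M : R, forall x, `|x * f x| <= M) -> \int[mu]_x f' x = 0.
Proof.
move=> df cf' if' [M hM].
have FTC (k : nat) :
    (\int[mu]_(x in `[(- k.+1%:R)%R, k.+1%:R%R]) (f' x)%:E = (f k.+1%:R - f (- k.+1%:R))%:E)%E.
  rewrite (@continuous_FTC2 _ f' f)//.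
  - by rewrite -subr_gt0 opprK addr_gt0.
  - exact: continuous_subspaceT.
  - have cf y : {for y, continuous f}.
      by apply/differentiable_continuous/derivable1_diffP; have [] := df y.
    split => //.
    + by apply: cvg_at_right_filter; exact: cf.
    + by apply: cvg_at_left_filter; exact: cf.
  - by move=> y _; rewrite derive1E; have [] := df y.
have c0 : (f k.+1%:R - f (- k.+1%:R)) @[k --> \oo] --> (0 : R).
  apply: norm_cvg0.
  apply: (@squeeze_cvgr _ _ _ _ (cst 0) (fun k : nat => 2 * M * k.+1%:R^-1)).
  - apply: nearW => k; rewrite normr_ge0/=.
    have k0 : (0 : R) < k.+1%:R by [].
    rewrite ler_pdivlMr// (le_trans (ler_wpM2r _ (ler_normB _ _)))// mulrDl.
    have := hM k.+1%:R; have := hM (- k.+1%:R).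
    by rewrite !normrM normrN !(gtr0_norm k0); lra.
  - exact: cvg_cst.
  - rewrite -[X in _ --> X](mulr0 (2 * M)); apply: cvgM; first exact: cvg_cst.
    exact: cvg_harmonic.
have c1 : (\int[mu]_(x in `[(- k.+1%:R)%R, k.+1%:R%R]) (f' x)%:E)%E @[k --> \oo] -->
    (\int[mu]_x (f' x)%:E)%E.
  under eq_fun do rewrite integral_mkcond.
  have mf' : measurable_fun setT f' by exact: continuous_measurable_fun.
  have [|||||_ _] := @dominated_convergence _ _ _ mu _ measurableT
    (fun k : nat => (EFin \o f') \_ `[(- k.+1%:R)%R, k.+1%:R%R]) (EFin \o f')
    (fun x => `|(EFin \o f') x|%E); last by [].
  - move=> k; apply/(measurable_restrictT _ _).1 => //.
    by apply/measurable_funTS/measurable_EFinP.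
  - exact/measurable_EFinP.
  - apply: aeW => x _; apply: cvg_near_cst.
    (* Once [k] reaches the integer part of [|x|], the interval contains [x], so the truncations are
       eventually constant at [x]. *)
    near=> k; rewrite patchE ifT// inE/= in_itv/= -ler_norml.
    have : (Num.trunc `|x|).+1%:R <= k.+1%:R :> R.
      by rewrite ler_nat ltnS; near: k; exact: nbhs_infty_ge.
    by apply: le_trans; exact/ltW/Num.Theory.truncnS_gt.
  - exact/integrable_abse.
  - apply: aeW => x k _; rewrite patchE; case: ifPn => //= _.
    by rewrite normr0 lee_fin.
move: c1; under eq_fun do rewrite FTC.
move=> c1.
have c2 : (f k.+1%:R - f (- k.+1%:R))%:E @[k --> \oo] --> 0%:E.
  by apply: cvg_EFin => //; exact: nearW.
by rewrite /Rintegral (cvg_unique _ c1 c2).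
Unshelve. all: by end_near.
Qed.

(* The phase [th] handles the real part ([th = 0]) and the imaginary part
   ([th = pi / 2]) of the Fourier integral together. *)
Definition gauss_moment (k : nat) a th w : R :=
  \int[mu]_x (x ^+ k * gauss a x * cos (w * x - th)).

(** With this, differentiating the cosine amounts to a phase shift, and derivatives stay in the
    family of integrands of [gauss_moment]. *)
Lemma cosBpihalf x : cos (x - pi / 2) = sin x.
Proof. by rewrite cosB cos_pihalf sin_pihalf mulr0 add0r mulr1. Qed.

(** For [k = 0] the truncated predecessor [k.-1] is harmless, since its coefficient [k%:R] is 0. *)
Lemma is_derive_monom_gauss_cos (k : nat) a th w x :
  is_derive x 1 (fun x => x ^+ k * gauss a x * cos (w * x - th))
    (k%:R * (x ^+ k.-1 * gauss a x * cos (w * x - th))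
     - 2 * pi * a * (x ^+ k.+1 * gauss a x * cos (w * x - th))
     - w * (x ^+ k * gauss a x * cos (w * x - (th + pi / 2)))).
Proof.
have hg := is_derive_gauss a x.
have hk : is_derive x 1 (fun x : R => x ^+ k) (k%:R * x ^+ k.-1).
  apply: DeriveDef; first exact: exprn_derivable.
  by rewrite exp_derive /GRing.scale /= mulr1.
have hc : is_derive x 1 (fun x => cos (w * x - th)) (- sin (w * x - th) * w).
  by apply: is_derive_eq; rewrite /GRing.scale /= mulr1 oppr0 addr0.
apply: (is_derive_eq (is_deriveM (is_deriveM hk hg) hc)).
rewrite opprD addrA cosBpihalf /GRing.scale /= !fctE exprS; ring.
Qed.

Lemma integrable_monom_gauss_cos (k : nat) a th w : 0 < a ->
  integ (fun x => x ^+ k * gauss a x * cos (w * x - th)).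
Proof. by move=> a0; apply: integrable_mul_cos; exact: integrable_monom_gauss. Qed.

Lemma continuous_monom_gauss_cos (k : nat) a th w :
  continuous (fun x => x ^+ k * gauss a x * cos (w * x - th)).
Proof.
move=> x; apply/differentiable_continuous/derivable1_diffP.
by have [] := is_derive_monom_gauss_cos k a th w x.
Qed.

(* The derivative of [x ^ k * gauss a x * cos (w * x - th)] integrates to 0. *)
Lemma gauss_moment_rec (k : nat) a th w : 0 < a ->
  k%:R * gauss_moment k.-1 a th w - 2 * pi * a * gauss_moment k.+1 a th w
  - w * gauss_moment k a (th + pi / 2) w = 0.
Proof.
move=> a0; have igc := integrable_monom_gauss_cos _ _ _ a0.
have iZ c j th' := integrableR_scale c (igc j th' w).
rewrite /gauss_moment -!RintegralZl//; try exact: igc.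
rewrite -!RintegralB//; try exact: iZ; last first.
  by apply: integrableR_sub; exact: iZ.
apply: Rintegral_derive_eq0 (fun x => is_derive_monom_gauss_cos k a th w x) _ _ _.
- have cZ c j th' x : {for x, continuous (fun y => c * (y ^+ j * gauss a y * cos (w * y - th')))}.
    by apply: cvgM; [exact: cvg_cst|exact: continuous_monom_gauss_cos].
  by move=> x; apply: cvgB; [apply: cvgB|]; exact: cZ.
- by apply: integrableR_sub; [apply: integrableR_sub|]; exact: iZ.
- have [M hM] := monom_gauss_bound k.+1 a0; exists M => x.
  rewrite !mulrA -exprS normrM (le_trans _ (hM x))// ler_piMr//.
  exact: norm_cos_le1.
Qed.

(** Differentiation under the integral produces minus the first moment at phase [th + pi / 2], and
    the recurrence turns it back into the zeroth moment. The result is a linear differential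
    equation in [w]. *)
Lemma is_derive_gauss_moment0 a th w : 0 < a ->
  is_derive w 1 (gauss_moment 0 a th) (- (w / (2 * pi * a)) * gauss_moment 0 a th w).
Proof.
move=> a0; have p0 := pi_gt0 R.
pose f w x : R := x ^+ 0 * gauss a x * cos (w * x - th).
have df x y : is_derive x 1 (f^~ y) (- (y ^+ 1 * gauss a y * cos (x * y - (th + pi / 2)))).
  have hc : is_derive x 1 (fun x => cos (x * y - th)) (- sin (x * y - th) * y).
    by apply: is_derive_eq; rewrite /GRing.scale /= mulr1 mulr0 add0r subr0.
  apply: (is_derive_eq (is_deriveZ (x ^+ 0 * gauss a y) hc)).
  by rewrite opprD addrA cosBpihalf /GRing.scale /= !expr0 expr1; ring.
have dfE x y : partial1of2 f x y = - (y ^+ 1 * gauss a y * cos (x * y - (th + pi / 2))).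
  by rewrite partial1of2E; have [] := df x y.
(* The dominating function does not depend on the frequency, so any interval around [w] will do. *)
have wI : w \in `]w - 1, w + 1[ by rewrite in_itv/= ltrBlDr ltrDl ltr01.
have if1 x : integ (f x) by exact: integrable_monom_gauss_cos.
have der x y : derivable (f^~ y) x 1 by have [] := df x y.
have iG : integ (fun y => `|y ^+ 1 * gauss a y|).
  exact: (integrable_abse (integrable_monom_gauss 1 a0)).
have G_ub x y : `|partial1of2 f x y| <= `|y ^+ 1 * gauss a y|.
  rewrite dfE normrN normrM ler_piMr//.
  exact: norm_cos_le1.
have D := @derivable_under_integral _ _ _ mu f setT measurableT w (w - 1) (w + 1) wI
  (fun x _ => if1 x) (fun x y _ _ => der x y) _ (fun y => normr_ge0 _) iG (fun x y _ _ => G_ub x y).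
have E := @differentiation_under_integral _ _ _ mu f setT measurableT w (w - 1) (w + 1) wI
  (fun x _ => if1 x) (fun x y _ _ => der x y) _ (fun y => normr_ge0 _) iG (fun x y _ _ => G_ub x y).
apply: DeriveDef; first exact: D.
rewrite -derive1E E.
under eq_Rintegral do rewrite dfE -mulN1r.
rewrite RintegralZl//; last exact: integrable_monom_gauss_cos.
(* The recurrence shifts the phase by another [pi / 2]; at total shift [pi] the cosine only changes
   sign. *)
have := gauss_moment_rec 0 (th + pi / 2) w a0.
rewrite mul0r sub0r -addrA -splitr.
have -> : gauss_moment 0 a (th + pi) w = - gauss_moment 0 a th w.
  rewrite -[RHS]mulN1r /gauss_moment -RintegralZl//; last exact: if1.
  apply: eq_Rintegral => x _.
  by rewrite opprD addrA (cosB (_ - _)) cospi sinpi; ring.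
rewrite -/(gauss_moment 1 a (th + pi / 2) w) => h.
have {}h : 2 * pi * a * gauss_moment 1 a (th + pi / 2) w = w * gauss_moment 0 a th w.
  by move: h; lra.
have ne : 2 * pi * a != 0 by rewrite gt_eqF// !mulr_gt0.
by rewrite mulN1r mulNr; congr (- _); apply: (mulfI ne); rewrite h [RHS]mulrA; congr (_ * _);
  rewrite mulrC divfK.
Qed.

(** Multiplying by the integrating factor [expR (w ^+ 2 / (4 * pi * a))] gives a function with zero
    derivative; its constant value is read off at [w = 0] from the Gaussian integral. *)
Lemma gauss_moment0E a th w : 0 < a ->
  gauss_moment 0 a th w = cos th * ((Num.sqrt a)^-1 * expR (- (w ^+ 2 / (4 * pi * a)))).
Proof.
move=> a0; have p0 := pi_gt0 R; have ne : 2 * pi * a != 0 by rewrite gt_eqF// !mulr_gt0.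
pose h w := gauss_moment 0 a th w * expR (w ^+ 2 / (4 * pi * a)).
have dh x : is_derive x 1 h 0.
  have hm := is_derive_gauss_moment0 th x a0.
  have he : is_derive x 1 (fun w => expR (w ^+ 2 / (4 * pi * a)))
      (expR (x ^+ 2 / (4 * pi * a)) * (x / (2 * pi * a))).
    apply: is_derive_eq; congr (_ * _); rewrite /GRing.scale /= !mulr1.
    move: (pi : R) p0 {ne} => p p0; field; by rewrite !gt_eqF.
  by apply: (is_derive_eq (is_deriveM hm he)); rewrite /GRing.scale /=; ring.
have := is_derive_0_is_cst w 0 dh.
rewrite /h [in RHS]expr0n/= mul0r expR0 mulr1 => E.
have E0 : gauss_moment 0 a th 0 = cos th * (Num.sqrt a)^-1.
  rewrite /gauss_moment; under eq_Rintegral do rewrite mul0r sub0r cosN expr0 mul1r.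
  rewrite RintegralZr//; last exact: integrable_gauss.
  by rewrite /Rintegral integral_gauss//= mulrC.
by rewrite mulrA -E0 -E expRN mulfK// gt_eqF// expR_gt0.
Qed.

(** The recurrence at indices 0 and 1 reduces the first and second moments to the zeroth. Products
    of two components of the field involve each coordinate to degree at most 2. *)
Lemma gauss_momentE (k : nat) a th xi : 0 < a -> (k <= 2)%N ->
  gauss_moment k a th (2 * pi * xi) =
  (if k == 0%N then cos th else if k == 1%N then sin th * (xi / a)
   else cos th * ((2 * pi * a)^-1 - (xi / a) ^+ 2)) *
  ((Num.sqrt a)^-1 * gauss a^-1 xi).
Proof.
move=> a0; have p0 := pi_gt0 R; have ne : 2 * pi * a != 0 by rewrite gt_eqF// !mulr_gt0.
have E0 th' : gauss_moment 0 a th' (2 * pi * xi) =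
    cos th' * ((Num.sqrt a)^-1 * gauss a^-1 xi).
  rewrite gauss_moment0E//; do 2 congr (_ * _); congr expR; congr (- _).
  by move: (pi : R) p0 {ne} => p p0; field; rewrite !gt_eqF.
have E1 th' : gauss_moment 1 a th' (2 * pi * xi) =
    sin th' * (xi / a) * ((Num.sqrt a)^-1 * gauss a^-1 xi).
  have := gauss_moment_rec 0 th' (2 * pi * xi) a0.
  rewrite mul0r sub0r => /eqP; rewrite subr_eq0 eqr_oppLR => /eqP H.
  apply: (mulfI ne); rewrite H E0 cosD cos_pihalf sin_pihalf mulr0 mulr1 sub0r.
  move: (pi : R) (Num.sqrt a)^-1 p0 {ne H E0} => p s p0.
  by field; rewrite gt_eqF.
case: k => [|[|[|//]]] _ //=.
have := gauss_moment_rec 1 th (2 * pi * xi) a0.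
rewrite mul1r => /eqP; rewrite subr_eq0 subr_eq addrC -subr_eq => /eqP H.
apply: (mulfI ne); rewrite -H E0 E1 sinD cos_pihalf sin_pihalf mulr0 mulr1 add0r.
move: (pi : R) (Num.sqrt a)^-1 p0 {ne H E0 E1} => p s p0.
by field; rewrite !gt_eqF.
Qed.

End gauss1.

(** * Integration over row vectors *)

Section product_integrals.
Context d1 d2 (T1 : measurableType d1) (T2 : measurableType d2) {R : realType}.
Variables (m1 : {sigma_finite_measure set T1 -> \bar R})
  (m2 : {sigma_finite_measure set T2 -> \bar R}).

Lemma integrable_tensor (f : T1 -> R) (g : T2 -> R) :
  m1.-integrable setT (EFin \o f) -> m2.-integrable setT (EFin \o g) ->
  (m1 \x m2)%E.-integrable setT (EFin \o (fun p => f p.1 * g p.2)).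
Proof.
move=> fi gi.
have mf := integrableR_measurable fi; have mg := integrableR_measurable gi.
apply/integrable12ltyP.
  by apply/measurable_EFinP/measurable_funM; exact: measurableT_comp.
under eq_integral => x _.
  under eq_integral => y _ do rewrite /= normrM EFinM.
  rewrite ge0_integralZl//; last by apply/measurable_EFinP/measurableT_comp.
  over.
have /integrableP[_ hf] := fi; have /integrableP[_ hg] := gi.
have g0 : (0 <= \int[m2]_y `|(g y)%:E|)%E by exact: integral_ge0.
rewrite ge0_integralZr//; last first.
  by apply/measurable_EFinP/measurableT_comp.
apply: lte_mul_pinfty => //; first exact: integral_ge0.
by rewrite ge0_fin_numE// integral_ge0.
Qed.

Lemma Rintegral_prod1 (f : T1 * T2 -> R) :
  (m1 \x m2)%E.-integrable setT (EFin \o f) ->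
  (forall x, m2.-integrable setT (EFin \o (fun y => f (x, y)))) ->
  \int[(m1 \x m2)%E]_p f p = \int[m1]_x \int[m2]_y f (x, y).
Proof.
move=> fi f2; rewrite /Rintegral -integral12_prod_meas1//; congr fine.
apply: eq_integral => x _; rewrite fineK//.
move: (f2 x); exact: integrable_fin_num.
Qed.

Lemma Rintegral_prod2 (f : T1 * T2 -> R) :
  (m1 \x m2)%E.-integrable setT (EFin \o f) ->
  (forall y, m1.-integrable setT (EFin \o (fun x => f (x, y)))) ->
  \int[(m1 \x m2)%E]_p f p = \int[m2]_y \int[m1]_x f (x, y).
Proof.
move=> fi f1; rewrite /Rintegral -integral21_prod_meas1//; congr fine.
apply: eq_integral => y _; rewrite fineK//.
move: (f1 y); exact: integrable_fin_num.
Qed.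

End product_integrals.

Section integral_rV.
Context {R : realType}.
Local Notation mu := (@lebesgue_measure R).
Local Notation lam n := (@lebesgue_rV R n).

Lemma ge0_integral_rVS n (f : 'rV[R]_n.+1 -> \bar R) :
  measurable_fun setT f -> (forall x, (0 <= f x)%E) ->
  (\int[lam n.+1]_x f x = \int[mu]_x \int[lam n]_v f (rV_cons (x, v)))%E.
Proof.
move=> mf f0; have mc := @measurable_rV_cons R n.
rewrite -(fubini_tonelli1 (m1 := mu) (m2 := lam n) (f \o @rV_cons R n)).
- exact: (ge0_integral_pushforward mc (mu \x lam n)%E measurableT mf (fun x _ => f0 x)).
- exact: measurableT_comp mc.
- by move=> p; exact: f0.
Qed.

Lemma Rintegral_rVS n (f : 'rV[R]_n.+1 -> R) :
  measurable_fun setT f ->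
  (mu \x lam n)%E.-integrable setT (EFin \o (f \o @rV_cons R n)) ->
  (forall x, (lam n).-integrable setT (EFin \o (fun v => f (rV_cons (x, v))))) ->
  \int[lam n.+1]_x f x = \int[mu]_x \int[lam n]_v f (rV_cons (x, v)).
Proof.
move=> mf fi f2; rewrite -(Rintegral_prod1 fi)// /Rintegral; congr fine.
have mc := @measurable_rV_cons R n.
have mEf : measurable_fun setT (EFin \o f) by apply/measurable_EFinP.
exact: (@integral_pushforward _ _ _ _ _ _ mc (mu \x lam n)%E setT (EFin \o f) mEf fi measurableT).
Qed.

Definition prodf n (f : 'I_n -> R -> R) (x : 'rV[R]_n) : R := \prod_i f i (x 0 i).

Lemma prodf_cons n (f : 'I_n.+1 -> R -> R) (p : measurableTypeR R * 'rV[R]_n) :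
  prodf f (rV_cons p) = f ord0 p.1 * prodf (fun i => f (lift ord0 i)) p.2.
Proof.
rewrite /prodf big_ord_recl rV_cons0; congr (_ * _).
by apply: eq_bigr => i _; rewrite rV_consS.
Qed.

Lemma measurable_prodf n (f : 'I_n -> R -> R) :
  (forall i, measurable_fun setT (f i)) -> measurable_fun setT (prodf f).
Proof.
move=> mf; apply: measurable_prod => i _.
by apply: (measurableT_comp (mf i)); exact: measurable_rV_coord.
Qed.

Lemma integrable_prodf n (f : 'I_n -> R -> R) :
  (forall i, mu.-integrable setT (EFin \o f i)) ->
  (lam n).-integrable setT (EFin \o prodf f).
Proof.
elim: n f => [|n IH] f fi.
  (* In dimension 0 the measure is the Dirac mass at the only vector and the product is empty. *)
  have mp : measurable_fun setT (prodf f) by apply: measurable_prodf; case.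
  apply/integrableP; split; first exact/measurable_EFinP.
  rewrite integral_dirac//; last by apply/measurable_EFinP/measurableT_comp.
  by rewrite diracT mul1e ltry.
have mp : measurable_fun setT (prodf f).
  by apply: measurable_prodf => i; apply: integrableR_measurable (fi i).
apply: integrable_pushforward => //; [exact: measurable_rV_cons|exact/measurable_EFinP|].
rewrite preimage_setT.
have -> : (EFin \o prodf f) \o @rV_cons R n =
   EFin \o (fun p => f ord0 p.1 * prodf (fun i => f (lift ord0 i)) p.2).
  by apply/funext => p; rewrite /= prodf_cons.
by apply: integrable_tensor; [exact: fi|exact: IH].
Qed.

Lemma dotv_cons n (p : measurableTypeR R * 'rV[R]_n) (xi : 'rV[R]_n.+1) :
  dotv (rV_cons p) xi = p.1 * xi 0 0 + dotv p.2 (\row_j xi 0 (lift ord0 j)).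
Proof.
rewrite /dotv big_ord_recl rV_cons0; congr (_ + _).
by apply: eq_bigr => i _; rewrite rV_consS mxE.
Qed.

Lemma measurable_dotv d (T : measurableType d) n (f g : T -> 'rV[R]_n) :
  measurable_fun setT f -> measurable_fun setT g ->
  measurable_fun setT (fun x => dotv (f x) (g x)).
Proof.
move=> mf mg; apply: measurable_sum => i; apply: measurable_funM.
- exact: (measurable_fun_rVP f).1 mf i.
- exact: (measurable_fun_rVP g).1 mg i.
Qed.

Lemma measurable_cosine d (T : measurableType d) (f : T -> R) :
  measurable_fun setT f -> measurable_fun setT (fun x => cos (f x)).
Proof.
move=> mf; apply: measurableT_comp mf.
by apply: continuous_measurable_fun; exact: continuous_cos.
Qed.

Lemma measurable_cos_dotv d (T : measurableType d) n (f g : T -> 'rV[R]_n) (th : R) :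
  measurable_fun setT f -> measurable_fun setT g ->
  measurable_fun setT (fun x => cos (2 * pi * dotv (f x) (g x) - th)).
Proof.
move=> mf mg; apply: measurable_cosine; apply: measurable_funB => //.
by apply: measurable_funM => //; exact: measurable_dotv.
Qed.

Lemma integrable_mul_cos_dotv n (f : 'rV[R]_n -> R) (xi : 'rV[R]_n) (th : R) :
  (lam n).-integrable setT (EFin \o f) ->
  (lam n).-integrable setT (EFin \o (fun x => f x * cos (2 * pi * dotv x xi - th))).
Proof.
move=> fi; apply: (integrableR_bounded fi _ (M := 1)) => [|x].
- exact: measurable_cos_dotv.
- exact: norm_cos_le1.
Qed.

(* [z i] stands for the integral of [f i x * exp (2 i pi xi_i x)]. *)
Lemma cosine_integral_prodf n (f : 'I_n -> R -> R) (z : 'I_n -> R[i]) (xi : 'rV[R]_n) :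
  (forall i, mu.-integrable setT (EFin \o f i)) ->
  (forall i th, \int[mu]_x (f i x * cos (2 * pi * xi 0 i * x - th)) =
     complex.Re (z i) * cos th + complex.Im (z i) * sin th) ->
  forall th, \int[lam n]_x (prodf f x * cos (2 * pi * dotv x xi - th)) =
     complex.Re (\prod_i z i) * cos th + complex.Im (\prod_i z i) * sin th.
Proof.
elim: n f z xi => [|n IH] f z xi fi fz th.
  rewrite big_ord0 /= mul1r mul0r addr0 /Rintegral.
  rewrite integral_dirac//; last first.
    apply/measurable_EFinP; apply: measurable_funM; last exact: measurable_cos_dotv.
    by apply: measurable_prodf; case.
  by rewrite diracT mul1e /= /prodf /dotv !big_ord0 mulr0 sub0r cosN mul1r.
pose f' (i : 'I_n) := f (lift ord0 i); pose z' (i : 'I_n) := z (lift ord0 i).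
set xi' := \row_j xi 0 (lift ord0 j) : 'rV[R]_n.
have {}IH := IH f' z' xi' (fun i => fi _).
have {}IH : forall th, \int[lam n]_x (prodf f' x * cos (2 * pi * dotv x xi' - th)) =
    complex.Re (\prod_i z' i) * cos th + complex.Im (\prod_i z' i) * sin th.
  by apply: IH => i th'; rewrite mxE fz.
have Fi : (lam n).-integrable setT (EFin \o prodf f') by apply: integrable_prodf => i; exact: fi.
(* The first coordinate is absorbed into the phase of the remaining integral, which is why the
   induction runs over all phases. *)
have E x v : prodf f (rV_cons (x, v)) * cos (2 * pi * dotv (rV_cons (x, v)) xi - th) =
    f ord0 x * (prodf f' v * cos (2 * pi * dotv v xi' - (th - 2 * pi * xi 0 0 * x))).
  rewrite prodf_cons dotv_cons /= -mulrA; congr (_ * (_ * cos _)).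
  by rewrite mulrDr; ring.
have mf i : measurable_fun setT (f i) by apply: integrableR_measurable (fi i).
rewrite Rintegral_rVS; first last.
- move=> x; apply: eq_integrable (integrableR_scale (f ord0 x)
    (integrable_mul_cos_dotv xi' (th - 2 * pi * xi 0 0 * x) Fi)) => //.
  by move=> v _; rewrite /= E.
- have mc : measurable_fun setT (fun p => cos (2 * pi * dotv (@rV_cons R n p) xi - th)).
    by apply: measurable_cos_dotv => //; exact: measurable_rV_cons.
  apply: eq_integrable (integrableR_bounded (integrable_tensor (fi ord0) Fi) mc
    (fun p => norm_cos_le1 _)) => //.
  by move=> p _; rewrite /= prodf_cons.
- by apply: measurable_funM; [exact: measurable_prodf|exact: measurable_cos_dotv].
set Z := \prod_i z' i in IH.
have ic th' := integrable_mul_cos (2 * pi * xi 0 0) th' (fi ord0).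
(* The cosine and sine of the shifted phase become integrands of the first factor at phases [th] and
   [th + pi / 2]; their combination is the complex product of [z ord0] and [Z]. *)
transitivity (\int[mu]_x
    (complex.Re Z * (f ord0 x * cos (2 * pi * xi 0 0 * x - th)) -
     complex.Im Z * (f ord0 x * cos (2 * pi * xi 0 0 * x - (th + pi / 2))))).
  apply: eq_Rintegral => x _; under eq_Rintegral do rewrite E.
  rewrite RintegralZl//; last exact: integrable_mul_cos_dotv.
  rewrite IH (opprD th) addrA cosBpihalf -(opprB _ th) cosN sinN; ring.
rewrite RintegralB//; try exact: integrableR_scale.
rewrite !RintegralZl// !fz cosD sinD cos_pihalf sin_pihalf.
rewrite big_ord_recl -/Z; case: (z ord0) => a b; case: Z {IH} => c d /=; ring.
Qed.

(** The cosine transform is self-adjoint: its kernel is symmetric and bounded by 1, so Fubini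
    applies to the integrable tensor of [f] and [g]. *)
Lemma cosine_integral_swap n (f g : 'rV[R]_n -> R) :
  (lam n).-integrable setT (EFin \o f) -> (lam n).-integrable setT (EFin \o g) ->
  \int[lam n]_x (f x * \int[lam n]_xi (g xi * cos (2 * pi * dotv x xi))) =
  \int[lam n]_xi (g xi * \int[lam n]_x (f x * cos (2 * pi * dotv x xi))).
Proof.
move=> fi gi.
pose K (p : 'rV[R]_n * 'rV[R]_n) := f p.1 * g p.2 * cos (2 * pi * dotv p.1 p.2 - 0).
have Ki : (lam n \x lam n)%E.-integrable setT (EFin \o K).
  apply: (integrableR_bounded (integrable_tensor fi gi) _ (fun p => norm_cos_le1 _)).
  exact: measurable_cos_dotv.
have gci x : (lam n).-integrable setT (EFin \o (fun xi => g xi * cos (2 * pi * dotv x xi - 0))).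
  apply: (integrableR_bounded gi _ (fun p => norm_cos_le1 _)).
  exact: measurable_cos_dotv.
have fci xi := integrable_mul_cos_dotv xi 0 fi.
transitivity (\int[(lam n \x lam n)%E]_p K p).
  rewrite (Rintegral_prod1 Ki) => [|x].
    apply: eq_Rintegral => x _; rewrite -RintegralZl//; last first.
      by move: (gci x); under eq_fun do rewrite /= subr0.
    by apply: eq_Rintegral => xi _; rewrite /K /= subr0 mulrA.
  apply: eq_integrable (integrableR_scale (f x) (gci x)) => // xi _.
  by rewrite /K /= mulrA.
rewrite (Rintegral_prod2 Ki) => [|xi].
  apply: eq_Rintegral => xi _; rewrite -RintegralZl//; last first.
    by move: (fci xi); under eq_fun do rewrite /= subr0.
  by apply: eq_Rintegral => x _; rewrite /K /= subr0 mulrA (mulrC (g xi)).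
apply: eq_integrable (integrableR_scale (g xi) (fci xi)) => // x _.
by rewrite /K /= mulrA (mulrC (g xi)).
Qed.

(** The image of Lebesgue measure under multiplication by [c], times [c], has the right mass on
    half-open intervals, hence is Lebesgue measure by uniqueness. *)
Lemma ge0_integral_lebesgue_scale (c : R) (f : R -> \bar R) : 0 < c ->
  measurable_fun setT f -> (forall x, (0 <= f x)%E) ->
  (\int[mu]_x f x = c%:E * \int[mu]_x f (c * x)%R)%E.
Proof.
move=> c0 mf f0.
have mc : measurable_fun setT (fun x : measurableTypeR R => c * x : measurableTypeR R).
  exact: measurable_funM.
pose nu' : {measure set (measurableTypeR R) -> \bar R} :=
  mscale (NngNum (ltW c0))
    (pushforward mu (fun x : measurableTypeR R => c * x : measurableTypeR R)).
pose nu := nu' mc.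
have nuE (A : set (measurableTypeR R)) : measurable A -> mu A = nu A.
  apply: lebesgue_measure_unique.
  move=> _ [[a b] _ <-]; rewrite /nu /nu' /= /mscale /= /pushforward.
  have -> : (fun x => c * x) @^-1` `]a, b] = `](a / c), (b / c)]%classic.
    apply/seteqP; split=> x /=; rewrite !in_itv/= ltr_pdivrMr// ler_pdivlMr//;
      by rewrite mulrC.
  rewrite !lebesgue_measure_itv/= !lte_fin ltr_pM2r ?invr_gt0//.
  case: ifPn => _; last by rewrite mule0.
  by rewrite -!EFinB -EFinM -mulrBl mulrCA mulfV ?mulr1// gt_eqF.
rewrite (eq_measure_integral nu) => [|A mA _]; last exact: nuE.
rewrite /nu /nu' ge0_integral_mscale//; congr (_ * _)%E.
by rewrite ge0_integral_pushforward.
Qed.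

Definition scale_rV n (tau : 'I_n -> R) (v : 'rV[R]_n) : 'rV[R]_n :=
  \row_i (tau i * v 0 i).

Lemma measurable_scale_rV n (tau : 'I_n -> R) : measurable_fun setT (scale_rV tau).
Proof.
apply/measurable_fun_rVP => i.
rewrite (_ : _ \o _ = fun v => tau i * rV_coord i v); last first.
  by apply/funext => v; rewrite /rV_coord/= mxE.
by apply: measurable_funM => //; exact: measurable_rV_coord.
Qed.

Lemma scale_rV_cons n (tau : 'I_n.+1 -> R) x (v : 'rV[R]_n) :
  scale_rV tau (rV_cons (x, v)) =
  rV_cons (tau ord0 * x, scale_rV (fun i => tau (lift ord0 i)) v).
Proof.
apply/rowP => i; rewrite mxE; case: (unliftP ord0 i) => [j|] ->.
  by rewrite !rV_consS /= mxE.
by rewrite !rV_cons0.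
Qed.

(** Tonelli peels off one coordinate at a time, each contributing its own dilation factor to the
    Jacobian. *)
Lemma ge0_integral_rV_scale n (tau : 'I_n -> R) (f : 'rV[R]_n -> \bar R) :
  (forall i, 0 < tau i) -> measurable_fun setT f -> (forall x, (0 <= f x)%E) ->
  (\int[lam n]_x f x = (\prod_i tau i)%:E * \int[lam n]_x f (scale_rV tau x))%E.
Proof.
elim: n tau f => [|n IH] tau f tau0 mf f0.
  by rewrite big_ord0 mul1e; apply: eq_integral => x _; congr f; apply/rowP; case.
have mc := @measurable_rV_cons R n.
have mfc : measurable_fun setT (f \o @rV_cons R n) by exact: measurableT_comp mc.
have mfx x : measurable_fun setT (fun v => f (@rV_cons R n (x, v))).
  exact: (measurableT_comp mfc (pair1_measurable _)).
pose tau' (i : 'I_n) := tau (lift ord0 i).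
have t'0 : 0 <= \prod_i tau' i by apply: prodr_ge0 => i _; exact/ltW/tau0.
have mF := measurable_fun_fubini_tonelli_F (m2 := lam n) _ mfc (fun p => f0 _).
have mfs : measurable_fun setT (fun x => f (scale_rV tau x)).
  by apply: (measurableT_comp mf); exact: measurable_scale_rV.
rewrite [in RHS]ge0_integral_rVS// ge0_integral_rVS//.
rewrite (ge0_integral_lebesgue_scale (tau0 ord0) mF); last first.
  by move=> x; apply: integral_ge0 => v _; exact: f0.
rewrite big_ord_recl EFinM -muleA; congr (_ * _)%E.
rewrite -ge0_integralZl//.
- apply: eq_integral => x _; rewrite /fubini_F
    (IH tau' _ (fun i => tau0 _) (mfx _) (fun v => f0 _)).
  by congr (_ * _)%E; apply: eq_integral => v _; rewrite scale_rV_cons.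
- apply: (measurable_fun_fubini_tonelli_F (m2 := lam n)
    (fun p => f (scale_rV tau (@rV_cons R n p)))) => //.
  exact: (measurableT_comp mfs mc).
- by move=> x _; apply: integral_ge0 => v _; exact: f0.
Qed.

Lemma ge0_Rintegral_rV_scale n (tau : 'I_n -> R) (f : 'rV[R]_n -> R) :
  (forall i, 0 < tau i) -> measurable_fun setT f -> (forall x, 0 <= f x) ->
  (lam n).-integrable setT (EFin \o (f \o scale_rV tau)) ->
  \int[lam n]_x f x = \prod_i tau i * \int[lam n]_x f (scale_rV tau x).
Proof.
move=> tau0 mf f0 fi; rewrite /Rintegral (ge0_integral_rV_scale tau0).
- by rewrite fineM//; exact: (integrable_fin_num measurableT fi).
- exact/measurable_EFinP.
- by move=> x; rewrite lee_fin.
Qed.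

End integral_rV.

(** * Gaussian polynomials are Schwartz functions *)

Section gauss_schwartz.
Context {R : realType} {n : nat}.
Variable c : 'I_n -> R.
Hypothesis c0 : forall i, 0 < c i.
Implicit Types (f g : 'rV[R]_n -> R).

Definition gaussn : 'rV[R]_n -> R := prodf (fun i => gauss (c i)).

Lemma is_derive_coord (x v : 'rV[R]_n) i : is_derive x v (fun y : 'rV[R]_n => y 0 i) (v 0 i).
Proof.
have lin : linear (fun y : 'rV[R]_n => y 0 i) by move=> k u w; rewrite !mxE.
pose f : {linear 'rV[R]_n -> R} := HB.pack (fun y : 'rV[R]_n => y 0 i)
  (GRing.isLinear.Build _ _ _ _ _ lin).
have cf : continuous f by exact: coord_continuous.
apply: DeriveDef; first by apply: diff_derivable; exact: differentiable_coord.
by rewrite deriveE ?(diff_lin _ cf)//; exact: differentiable_coord.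
Qed.

(** The exponent is a sum of functions rather than a function of sums, so that the rules for sums of
    differentiable functions apply directly. *)
Let q : 'rV[R]_n -> R := \sum_i (fun x : 'rV[R]_n => - (pi * c i) * (x 0 i * x 0 i) : R).

Let gaussnE : gaussn = expR \o q.
Proof.
apply/funext => x; rewrite /q /= fct_sumE expR_sum /gaussn /prodf.
by apply: eq_bigr => i _; rewrite /gauss mulNr expr2.
Qed.

Let differentiable_q x : differentiable q x.
Proof.
apply: differentiable_sum => i; apply: differentiableZ.
by apply: differentiableM; exact: differentiable_coord.
Qed.

Lemma is_derive_gaussn x v :
  is_derive x v gaussn (- (2 * pi) * (\sum_i c i * x 0 i * v 0 i) * gaussn x).
Proof.
have dq : is_derive x v q (- (2 * pi) * \sum_i c i * x 0 i * v 0 i).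
  have di i : is_derive x v (fun x : 'rV[R]_n => - (pi * c i) * (x 0 i * x 0 i))
      (- (2 * pi) * (c i * x 0 i * v 0 i)).
    have dx := is_derive_coord x v i.
    apply: (is_derive_eq (is_deriveZ (- (pi * c i)) (is_deriveM dx dx))).
    by rewrite /GRing.scale /=; ring.
  by apply: (is_derive_eq (is_derive_sum di)); rewrite mulr_sumr.
have de : differentiable expR (q x) by apply/derivable1_diffP; exact: derivable_expR.
rewrite gaussnE; apply: DeriveDef.
  by apply: diff_derivable; exact: differentiable_comp.
rewrite deriveE; last exact: differentiable_comp.
rewrite diff_comp//= -(deriveE v (differentiable_q x)) diff1E//.
by rewrite derive1E; have [_ ->] := dq; have [_ ->] := is_derive_expR (q x).
Qed.

Lemma differentiable_gaussn x : differentiable gaussn x.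
Proof.
rewrite gaussnE; apply: differentiable_comp => //.
by apply/derivable1_diffP; exact: derivable_expR.
Qed.

(** Polynomials times the Gaussian, generated inductively: closure under [partial] and decay then
    follow by induction on the generation. *)
Inductive gauss_poly : ('rV[R]_n -> R) -> Prop :=
| gauss_poly_gauss : gauss_poly gaussn
| gauss_poly_coord i f : gauss_poly f -> gauss_poly (fun x => x 0 i * f x)
| gauss_poly_add f g : gauss_poly f -> gauss_poly g -> gauss_poly (fun x => f x + g x)
| gauss_poly_scale k f : gauss_poly f -> gauss_poly (fun x => k * f x).

Lemma gauss_poly_differentiable f : gauss_poly f -> forall x, differentiable f x.
Proof.
elim=> [|i {}f _ IH|{}f g _ IHf _ IHg|k {}f _ IH] x.
- exact: differentiable_gaussn.
- by apply: differentiableM => //; exact: differentiable_coord.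
- exact: differentiableD.
- exact: differentiableZ.
Qed.

Lemma partial_gaussn i : partial i gaussn = (fun x => - (2 * pi * c i) * (x 0 i * gaussn x)).
Proof.
apply/funext => x; rewrite /partial; have [_ ->] := is_derive_gaussn x (delta_mx 0 i).
rewrite (bigD1 i)//= big1 => [|j ji]; last by rewrite mxE eqxx (negbTE ji) mulr0.
by rewrite mxE !eqxx mulr1 addr0; ring.
Qed.

Lemma partial_coordM i j f : (forall x, differentiable f x) ->
  partial i (fun x => x 0 j * f x) = (fun x => (i == j)%:R * f x + x 0 j * partial i f x).
Proof.
move=> df; apply/funext => x; rewrite /partial.
have dx := is_derive_coord x (delta_mx 0 i) j.
have dfx : is_derive x (delta_mx 0 i) f ('D_(delta_mx 0 i) f x).
  by apply: DeriveDef => //; exact: diff_derivable.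
have [_ ->] := is_deriveM dx dfx.
by rewrite mxE eqxx /= eq_sym /GRing.scale /= addrC mulrC.
Qed.

Lemma gauss_poly_partial f i : gauss_poly f -> gauss_poly (partial i f).
Proof.
elim=> [|j {}f fg IH|{}f g fg IHf gg IHg|k {}f fg IH].
- by rewrite partial_gaussn; do 2 constructor; constructor.
- rewrite partial_coordM; last exact: gauss_poly_differentiable.
  by apply: gauss_poly_add; [exact: gauss_poly_scale|exact: gauss_poly_coord].
- have -> : partial i (fun x => f x + g x) = fun x => partial i f x + partial i g x.
    apply/funext => x; rewrite /partial deriveD//;
      by apply: diff_derivable; exact: gauss_poly_differentiable.
  exact: gauss_poly_add.
- have -> : partial i (fun x => k * f x) = fun x => k * partial i f x.
    apply/funext => x; rewrite /partial deriveZ//.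
    by apply: diff_derivable; exact: gauss_poly_differentiable.
  exact: gauss_poly_scale.
Qed.

(** The exponents [a] are universally quantified inside the induction, because a coordinate factor
    is absorbed by raising one exponent of the monomial. *)
Lemma gauss_poly_bounded f : gauss_poly f ->
  forall a : 'I_n -> nat, exists M : R, forall x, `|monomial a x * f x| <= M.
Proof.
elim=> [|i {}f _ IH|{}f g _ IHf _ IHg|k {}f _ IH] a.
- have /choice[M hM] i := monom_gauss_bound (a i) (c0 i).
  exists (\prod_i M i) => x; rewrite /monomial /gaussn /prodf -big_split/= normr_prod.
  by apply: ler_prod => i _; rewrite normr_ge0/=.
- have [M hM] := IH (fun j => (a j + (j == i))%N); exists M => x.
  apply: le_trans (hM x); rewrite mulrA.
  have -> : monomial (fun j => (a j + (j == i))%N) x = monomial a x * x 0 i; last by [].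
  rewrite /monomial; under eq_bigr do rewrite exprD.
  rewrite big_split/=; congr (_ * _); rewrite (bigD1 i)//= eqxx expr1 big1 ?mulr1//.
  by move=> j /negbTE ->; rewrite expr0.
- have [M1 h1] := IHf a; have [M2 h2] := IHg a; exists (M1 + M2) => x.
  by rewrite mulrDr (le_trans (ler_normD _ _))// lerD.
- have [M hM] := IH a; exists (`|k| * M) => x.
  by rewrite mulrCA normrM ler_wpM2l.
Qed.

Lemma gauss_poly_schwartz f : gauss_poly f -> schwartz f.
Proof.
move=> fg; have pg s : gauss_poly (partials s f).
  by elim: s => //= i s IH; exact: gauss_poly_partial.
split=> [s x|a s]; first exact: gauss_poly_differentiable.
exact: gauss_poly_bounded.
Qed.

End gauss_schwartz.

(** * Means of integrable cosine transforms *)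

Lemma Rintegral_dominated_cvg d (T : measurableType d) (R : realType)
    (mu : {measure set T -> \bar R}) (f_ : nat -> T -> R) (f g : T -> R) :
  (forall m, measurable_fun setT (f_ m)) -> measurable_fun setT f ->
  {ae mu, forall x, f_ m x @[m --> \oo] --> f x} ->
  mu.-integrable setT (EFin \o g) ->
  (forall m x, `|f_ m x| <= g x) ->
  \int[mu]_x f_ m x @[m --> \oo] --> \int[mu]_x f x.
Proof.
move=> mf_ mf cf gi fg.
have [||||fi _ h] := @dominated_convergence _ _ _ mu _ measurableT
  (fun m => EFin \o f_ m) (EFin \o f) (EFin \o g) _ _ _ gi.
- by move=> m; apply/measurable_EFinP.
- exact/measurable_EFinP.
- by apply: filterS cf => x cx _; apply: cvg_EFin => //; exact: nearW.
- by apply: aeW => x m _; rewrite lee_fin.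
apply: fine_cvg; rewrite fineK//.
exact: integrable_fin_num fi.
Qed.

Section gaussian_mean.
Context {R : realType} {n : nat}.
Implicit Types (c tau : 'I_n -> R) (x xi eta : 'rV[R]_n).
Local Notation lam := (@lebesgue_rV R n).

Lemma gaussn_gt0 c x : 0 < gaussn c x.
Proof. by apply: prodr_gt0 => i _; exact: gauss_gt0. Qed.

Lemma gaussn_le1 c x : (forall i, 0 <= c i) -> gaussn c x <= 1.
Proof.
move=> c0; apply: prodr_ile1 => i _.
by rewrite gauss_le1// ltW// gauss_gt0.
Qed.

Lemma gaussn_scale c tau x :
  gaussn c (scale_rV tau x) = gaussn (fun i => c i * tau i ^+ 2) x.
Proof.
apply: eq_bigr => i _; rewrite mxE /gauss exprMn; congr expR.
by rewrite -!mulrA.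
Qed.

Lemma measurable_gaussn c : measurable_fun setT (gaussn c).
Proof. by apply: measurable_prodf => i; exact: measurable_gauss. Qed.

Lemma integrable_gaussn c : (forall i, 0 < c i) -> lam.-integrable setT (EFin \o gaussn c).
Proof. by move=> c0; apply: integrable_prodf => i; exact: integrable_gauss. Qed.

Lemma cosine_integral_gaussn c xi : (forall i, 0 < c i) ->
  \int[lam]_x (gaussn c x * cos (2 * pi * dotv x xi)) =
  (\prod_i (Num.sqrt (c i))^-1) * gaussn (fun i => (c i)^-1) xi.
Proof.
move=> c0; pose z i : R[i] := ((Num.sqrt (c i))^-1 * gauss (c i)^-1 (xi 0 i))%:C%C.
have hz i th : \int[lebesgue_measure]_x (gauss (c i) x * cos (2 * pi * xi 0 i * x - th)) =
    complex.Re (z i) * cos th + complex.Im (z i) * sin th.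
  have := @gauss_momentE _ 0 (c i) th (xi 0 i) (c0 i) isT; rewrite /z /= => h.
  rewrite mul0r addr0 [RHS]mulrC -h /gauss_moment.
  by apply: eq_Rintegral => x _; rewrite mul1r.
have := cosine_integral_prodf (fun i => integrable_gauss (c0 i)) hz 0.
under eq_Rintegral do rewrite subr0.
move=> ->; rewrite -rmorph_prod /= cos0 sin0 mulr1 mulr0 addr0.
by rewrite big_split.
Qed.

(** An integral is the cosine transform at frequency 0. *)
Lemma Rintegral_gaussn1 : \int[lam]_x gaussn (fun=> 1) x = 1.
Proof.
have := @cosine_integral_gaussn (fun=> 1) 0 (fun=> ltr01).
have d0 x : dotv x (0 : 'rV[R]_n) = 0.
  by rewrite /dotv big1// => i _; rewrite mxE mulr0.
under eq_Rintegral do rewrite d0 mulr0 cos0 mulr1.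
move=> ->; rewrite sqrtr1 invr1 big1// mul1r /gaussn /prodf big1// => i _.
by rewrite mxE gauss0.
Qed.

Lemma dotv_ge0 xi : 0 <= dotv xi xi.
Proof. by apply: sumr_ge0 => i _; rewrite -expr2 sqr_ge0. Qed.

Lemma measurable_dotv_inv : measurable_fun setT (fun xi => (dotv xi xi)^-1).
Proof.
under eq_fun do rewrite -powR_inv1 ?dotv_ge0//.
by apply: measurableT_comp (measurable_powR _) _; exact: measurable_dotv.
Qed.

(** This is [- \sum_i b i * riesz_symbol i i], homogeneous of degree 0 away from the origin and
    equal to [b j] along the [j]-th axis there. *)
Definition quadratic_symbol (b : 'I_n -> R) xi : R :=
  (\sum_i b i * xi 0 i ^+ 2) / dotv xi xi.

Lemma measurable_quadratic_symbol b : measurable_fun setT (quadratic_symbol b).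
Proof.
apply: measurable_funM; last exact: measurable_dotv_inv.
apply: measurable_sum => i; apply: measurable_funM => //.
by apply: measurable_funX; exact: measurable_rV_coord.
Qed.

Lemma quadratic_symbol_ge0 b xi : (forall i, 0 <= b i) -> 0 <= quadratic_symbol b xi.
Proof.
move=> b0; apply: divr_ge0; last exact: dotv_ge0.
by apply: sumr_ge0 => i _; rewrite mulr_ge0 ?sqr_ge0.
Qed.

Lemma quadratic_symbol_le b xi : (forall i, 0 <= b i) ->
  quadratic_symbol b xi <= \sum_i b i.
Proof.
move=> b0; have := dotv_ge0 xi; rewrite le_eqVlt => /orP[/eqP h|h].
  by rewrite /quadratic_symbol -h invr0 mulr0 sumr_ge0.
rewrite ler_pdivrMr// mulr_suml ler_sum// => i _; rewrite ler_wpM2l//.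
rewrite /dotv (bigD1 i)//= -expr2 lerDl sumr_ge0// => k _.
by rewrite -expr2 sqr_ge0.
Qed.

(** The excluded hyperplane is a box whose [j]-th side is a single point, so its measure is a
    product with a zero factor. *)
Lemma ae_coord_neq0 (j : 'I_n) : {ae lam, forall x : 'rV[R]_n, x 0 j != 0}.
Proof.
pose A (i : 'I_n) : set (measurableTypeR R) := if i == j then [set 0] else setT.
have mA i : measurable (A i) by rewrite /A; case: ifP.
exists [set v : 'rV[R]_n | forall i, A i (v 0 i)]; split.
- exact: measurable_rV_box.
- rewrite lebesgue_rV_box// (bigD1 j)//= {1}/A eqxx.
  by rewrite lebesgue_measure_set1 mul0e.
- move=> v /= /negP; rewrite negbK => /eqP vj i; rewrite /A.
  by case: eqP => // ->.
Qed.

(* Coordinate [j] is contracted more slowly than the others, so that in the limit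
   the frequencies concentrate along the [j]-th axis. *)
Definition axis_scaling (j : 'I_n) (t : R) (i : 'I_n) : R := if i == j then t else t ^+ 2.

Lemma axis_scaling_gt0 j t i : 0 < t -> 0 < axis_scaling j t i.
Proof. by move=> t0; rewrite /axis_scaling; case: ifP => // _; rewrite exprn_gt0. Qed.

Lemma cvg_axis_scaling j i : axis_scaling j m.+1%:R^-1 i @[m --> \oo] --> (0 : R).
Proof.
have h : m.+1%:R^-1 @[m --> \oo] --> (0 : R) by exact: cvg_harmonic.
rewrite /axis_scaling; case: (i == j); first exact: h.
by have := cvgM h h; rewrite mulr0; apply.
Qed.

Lemma cvg_gaussn_axis_scaling c j x :
  gaussn c (scale_rV (axis_scaling j m.+1%:R^-1) x) @[m --> \oo] --> (1 : R).
Proof.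
have e1 : \prod_i gauss (c i) (0 * x 0 i) = 1 :> R.
  by rewrite big1// => i _; rewrite mul0r gauss0.
rewrite -[X in _ --> X]e1.
rewrite /gaussn /prodf; under eq_fun do under eq_bigr do rewrite mxE.
apply: (cvg_big mul_continuous) => i _.
apply: continuous_cvg; first exact: continuous_gauss.
by apply: cvgM; [exact: cvg_axis_scaling|exact: cvg_cst].
Qed.

Lemma cvg_quadratic_symbol_axis_scaling b j x : x 0 j != 0 ->
  quadratic_symbol b (scale_rV (axis_scaling j m.+1%:R^-1) x) @[m --> \oo] --> b j.
Proof.
move=> xj.
(* After cancelling a common [t ^+ 2], the off-axis terms still carry [t ^+ 2] and vanish in the
   limit. *)
have E t : t != 0 -> quadratic_symbol b (scale_rV (axis_scaling j t) x) =
    (b j * x 0 j ^+ 2 + t ^+ 2 * \sum_(i | i != j) b i * x 0 i ^+ 2) /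
    (x 0 j ^+ 2 + t ^+ 2 * \sum_(i | i != j) x 0 i ^+ 2).
  move=> t0; have t20 : t ^+ 2 != 0 by exact: expf_neq0.
  rewrite -[RHS]mul1r -(divff t20) mulf_div /quadratic_symbol /dotv.
  congr (_ / _); rewrite (bigD1 j)//= mulrDr !mxE /axis_scaling eqxx.
    congr (_ + _); first by ring.
    rewrite !mulr_sumr; apply: eq_bigr => i /negbTE ij.
    by rewrite mxE ij; ring.
  congr (_ + _); first by ring.
  rewrite !mulr_sumr; apply: eq_bigr => i /negbTE ij.
  by rewrite mxE ij; ring.
under eq_fun do rewrite E ?invr_neq0//.
have h : m.+1%:R^-1 @[m --> \oo] --> (0 : R) by exact: cvg_harmonic.
have h2 : m.+1%:R^-1 ^+ 2 @[m --> \oo] --> (0 : R) by have := cvgM h h; rewrite mulr0; apply.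
have hl (u v : R) : u + m.+1%:R^-1 ^+ 2 * v @[m --> \oo] --> u.
  rewrite -[X in _ --> X]addr0 -[X in u + X](mul0r v).
  by apply: cvgD; [exact: cvg_cst|apply: cvgM => //; exact: cvg_cst].
have x2 : x 0 j ^+ 2 != 0 by exact: expf_neq0.
have := cvgM (hl (b j * x 0 j ^+ 2) (\sum_(i | i != j) b i * x 0 i ^+ 2))
  (cvgV x2 (hl (x 0 j ^+ 2) (\sum_(i | i != j) x 0 i ^+ 2))).
by rewrite mulfK//; apply.
Qed.

Section cosine_transform_mean.
Variables (al b : 'I_n -> R).
Hypotheses (al0 : forall i, 0 < al i) (b0 : forall i, 0 <= b i).

Let rho xi := gaussn al xi * quadratic_symbol b xi.

Let mrho : measurable_fun setT rho.
Proof.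
by apply: measurable_funM; [exact: measurable_gaussn|exact: measurable_quadratic_symbol].
Qed.

Let rho_ge0 xi : 0 <= rho xi.
Proof. by rewrite mulr_ge0 ?quadratic_symbol_ge0// ltW ?gaussn_gt0. Qed.

Let rho_le xi : rho xi <= \sum_i b i.
Proof.
rewrite -[leRHS]mul1r ler_pM ?quadratic_symbol_ge0 ?quadratic_symbol_le//.
- exact/ltW/gaussn_gt0.
- by apply: gaussn_le1 => i; exact/ltW/al0.
Qed.

Lemma integrable_gaussn_quadratic_symbol : lam.-integrable setT (EFin \o rho).
Proof.
apply: (integrableR_bounded (integrable_gaussn al0) (M := \sum_i b i)).
  exact: measurable_quadratic_symbol.
by move=> xi; rewrite ger0_norm ?quadratic_symbol_ge0// quadratic_symbol_le.
Qed.

(** In the application this is minus the real part of the pressure. *)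
Let P x := \int[lam]_xi (rho xi * cos (2 * pi * dotv x xi)).

(** Self-adjointness moves the transform onto the Gaussian, giving one concentrated near the origin.
    Rescaling frequencies by [tau] normalises it, and the Jacobian cancels its prefactor. *)
Let integral_P_gaussn tau : (forall i, 0 < tau i) ->
  \int[lam]_x (gaussn (fun i => tau i ^+ 2) x * P x) =
  \int[lam]_xi (gaussn (fun=> 1) xi * rho (scale_rV tau xi)).
Proof.
move=> tau0; have tau20 i : 0 < tau i ^+ 2 by rewrite exprn_gt0.
have prod0 : 0 < \prod_i tau i by apply: prodr_gt0.
pose F xi := rho xi * ((\prod_i (tau i)^-1) * gaussn (fun i => (tau i ^+ 2)^-1) xi).
have FE xi : F (scale_rV tau xi) =
    (\prod_i tau i)^-1 * (gaussn (fun=> 1) xi * rho (scale_rV tau xi)).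
  rewrite /F gaussn_scale prodfV mulrCA; congr (_ * _).
  rewrite (_ : (fun i => _) = fun=> 1); first by rewrite mulrC.
  by apply/funext => i; rewrite mulVf// gt_eqF.
have msc : measurable_fun setT (fun xi => rho (scale_rV tau xi)).
  by apply: (measurableT_comp mrho); exact: measurable_scale_rV.
have ig : lam.-integrable setT
    (EFin \o (fun xi => gaussn (fun=> 1) xi * rho (scale_rV tau xi))).
  apply: (integrableR_bounded (integrable_gaussn (fun=> ltr01)) msc (M := \sum_i b i)).
  by move=> xi; rewrite ger0_norm.
rewrite cosine_integral_swap; [|exact: integrable_gaussn|exact: integrable_gaussn_quadratic_symbol].
transitivity (\int[lam]_xi F xi).
  apply: eq_Rintegral => xi _; rewrite /F cosine_integral_gaussn//.
  congr (_ * (_ * _)); apply: eq_bigr => i _.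
  by rewrite sqrtr_sqr gtr0_norm.
rewrite (ge0_Rintegral_rV_scale tau0).
- under eq_Rintegral do rewrite FE.
  by rewrite RintegralZl// mulVKf// gt_eqF.
- apply: measurable_funM => //; apply: measurable_funM => //.
  exact: measurable_gaussn.
- move=> xi; rewrite mulr_ge0// mulr_ge0 ?(ltW (gaussn_gt0 _ _))//.
  by apply: prodr_ge0 => i _; rewrite invr_ge0 ltW.
- rewrite (_ : F \o _ = fun xi =>
    (\prod_i tau i)^-1 * (gaussn (fun=> 1) xi * rho (scale_rV tau xi))).
    exact: integrableR_scale.
  by apply/funext => xi; exact: FE.
Qed.

(** Both sides of [integral_P_gaussn] are passed to the limit: the left one is dominated by [|P|],
    the right one by a multiple of the standard Gaussian. The hypothesis does not mention [j], so
    integrability of [P] forces all [b j] to agree. *)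
Theorem Rintegral_cosine_transform_quadratic_symbol (j : 'I_n) :
  lam.-integrable setT (EFin \o P) -> \int[lam]_x P x = b j.
Proof.
move=> Pi; pose tau m := axis_scaling j (m.+1%:R^-1 : R).
have tau0 m i : 0 < tau m i by apply: axis_scaling_gt0; rewrite invr_gt0.
have lhs : \int[lam]_x (gaussn (fun i => tau m i ^+ 2) x * P x) @[m --> \oo] -->
    \int[lam]_x P x.
  apply: (@Rintegral_dominated_cvg _ _ _ _ _ _ (fun x => `|P x|)).
  - move=> m; apply: measurable_funM; first exact: measurable_gaussn.
    exact: integrableR_measurable Pi.
  - exact: integrableR_measurable Pi.
  - apply: aeW => x; rewrite -[X in _ --> X]mul1r; apply: cvgM; last exact: cvg_cst.
    have := cvg_gaussn_axis_scaling (fun=> 1) j x.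
    by under eq_fun do rewrite gaussn_scale; under eq_fun do under eq_fun do rewrite mul1r.
  - exact: integrable_abse Pi.
  - move=> m x; rewrite normrM ler_piMl// gtr0_norm ?gaussn_gt0//.
    by apply: gaussn_le1 => i; rewrite sqr_ge0.
have rhs : \int[lam]_xi (gaussn (fun=> 1) xi * rho (scale_rV (tau m) xi)) @[m --> \oo] -->
    \int[lam]_xi (gaussn (fun=> 1) xi * b j).
  apply: (@Rintegral_dominated_cvg _ _ _ _ _ _ (fun xi => (\sum_i b i) * gaussn (fun=> 1) xi)).
  - move=> m; apply: measurable_funM; first exact: measurable_gaussn.
    by apply: (measurableT_comp mrho); exact: measurable_scale_rV.
  - by apply: measurable_funM => //; exact: measurable_gaussn.
  (* The rescaled symbol tends to [b j] off the null hyperplane where the [j]-th coordinate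
     vanishes. *)
  - apply: filterS (ae_coord_neq0 j) => xi xij; apply: cvgM; first exact: cvg_cst.
    rewrite -[X in _ --> X]mul1r; apply: cvgM; first exact: cvg_gaussn_axis_scaling.
    exact: cvg_quadratic_symbol_axis_scaling.
  - by apply: integrableR_scale; exact: integrable_gaussn.
  - move=> m xi; rewrite normrM (gtr0_norm (gaussn_gt0 _ _)) mulrC ler_pM2r ?gaussn_gt0//.
    by rewrite ger0_norm.
move: lhs; under eq_fun do rewrite integral_P_gaussn//.
move=> lhs; rewrite (cvg_unique (@Rhausdorff R) lhs rhs).
by rewrite RintegralZr ?Rintegral_gaussn1 ?mul1r//; exact: integrable_gaussn.
Qed.

End cosine_transform_mean.

End gaussian_mean.

(** * The pressure of a Gaussian field *)

Section fourier_quadratic.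
Context {R : realType} {n : nat}.
Local Notation mu := (@lebesgue_measure R).
Local Notation lam := (@lebesgue_rV R n).
Implicit Types (f : 'rV[R]_n -> R) (x xi : 'rV[R]_n).
Local Open Scope complex_scope.

(** The imaginary part carries [- sin t = cos (t + pi / 2)], hence the phase [- (pi / 2)]. *)
Lemma fourier_real f xi : fourier (fun x => (f x)%:C) xi =
  (\int[lam]_x (f x * cos (2 * pi * dotv x xi - 0))) +i*
  (\int[lam]_x (f x * cos (2 * pi * dotv x xi - (- (pi / 2))))).
Proof.
rewrite /fourier /cintegral; congr (_ +i* _); apply: eq_Rintegral => x _ /=.
  by rewrite mul0r !subr0 cosN.
by rewrite mul0r addr0 opprK cosD cos_pihalf sin_pihalf sinN mulr0 mulr1 sub0r.
Qed.

Lemma Re_inv_fourier_real f x : complex.Re (inv_fourier (fun xi => (f xi)%:C) x) =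
  \int[lam]_xi (f xi * cos (2 * pi * dotv x xi)).
Proof. by apply: eq_Rintegral => xi _ /=; rewrite mul0r subr0. Qed.

Lemma fourier_realZ (k : R) f xi : lam.-integrable setT (EFin \o f) ->
  fourier (fun x => (k * f x)%:C) xi = k%:C * fourier (fun x => (f x)%:C) xi.
Proof.
move=> fi; rewrite !fourier_real.
have E th : \int[lam]_x (k * f x * cos (2 * pi * dotv x xi - th)) =
    k * \int[lam]_x (f x * cos (2 * pi * dotv x xi - th)).
  rewrite -RintegralZl//; last exact: integrable_mul_cos_dotv.
  by apply: eq_Rintegral => x _; rewrite mulrA.
by rewrite !E; apply/eqP; rewrite eq_complex /= !mul0r subr0 addr0 !eqxx.
Qed.

(** The conjugate appears because [z] is taken with the exponential of positive sign, whereas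
    [fourier] uses the negative sign. *)
Lemma fourier_prodf (f : 'I_n -> R -> R) (z : 'I_n -> R[i]) xi :
  (forall i, mu.-integrable setT (EFin \o f i)) ->
  (forall i th, \int[mu]_x (f i x * cos (2 * pi * xi 0 i * x - th)) =
     complex.Re (z i) * cos th + complex.Im (z i) * sin th) ->
  fourier (fun x => (prodf f x)%:C) xi = conjc (\prod_i z i).
Proof.
move=> fi fz; rewrite fourier_real !(cosine_integral_prodf fi fz).
rewrite cosN sinN cos0 sin0 cos_pihalf sin_pihalf !mulr0 mulr1 addr0 add0r mulrN1.
by case: (\prod_i z i).
Qed.

Variable a : 'I_n -> R.
Hypothesis a0 : forall i, 0 < a i.

(** The exponent of the [i]-th coordinate in [x_p x_q], treating [p = q] and [p != q] uniformly. *)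
Let e (p q i : 'I_n) : nat := ((i == p) + (i == q))%N.

Let e_le2 p q i : (e p q i <= 2)%N.
Proof. by rewrite /e; case: (i == p); case: (i == q). Qed.

Let coord2_gaussnE p q x : x 0 p * x 0 q * gaussn a x =
  prodf (fun i y => y ^+ e p q i * gauss (a i) y) x.
Proof.
have E (r : 'I_n) : \prod_i x 0 i ^+ (i == r) = x 0 r.
  rewrite (bigD1 r)//= eqxx expr1 big1 ?mulr1// => i /negbTE ->.
  by rewrite expr0.
rewrite /prodf big_split/=; congr (_ * _).
by rewrite -{1}(E p) -{1}(E q) -big_split/=; apply: eq_bigr => i _; rewrite exprD.
Qed.

Lemma integrable_coord2_gaussn p q :
  lam.-integrable setT (EFin \o (fun x => x 0 p * x 0 q * gaussn a x)).
Proof.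
rewrite (_ : (fun x => _) = prodf (fun i y => y ^+ e p q i * gauss (a i) y)).
  by apply: integrable_prodf => i; exact: integrable_monom_gauss.
by apply/funext => x; exact: coord2_gaussnE.
Qed.

(** The transform factors over coordinates. For [p = q] one factor is a second moment; for [p != q]
    two imaginary first moments multiply to a negative real. The product is real in both cases, so
    conjugation has no effect. *)
Lemma fourier_coord2_gaussn p q xi :
  fourier (fun x => (x 0 p * x 0 q * gaussn a x)%:C) xi =
  ((\prod_i (Num.sqrt (a i))^-1) * gaussn (fun i => (a i)^-1) xi *
   ((p == q)%:R / (2 * pi * a p) - xi 0 p / a p * (xi 0 q / a q)))%:C.
Proof.
(* The ratio of the [k]-th to the zeroth Gaussian moment, as a complex number: the coefficient of
   [cos th] in [gauss_momentE] is its real part, that of [sin th] its imaginary part. *)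
pose zeta (k : nat) (i : 'I_n) : R[i] :=
  if k == 0%N then 1 else if k == 1%N then 0 +i* (xi 0 i / a i)
  else ((2 * pi * a i)^-1 - (xi 0 i / a i) ^+ 2)%:C.
pose w i := (Num.sqrt (a i))^-1 * gauss (a i)^-1 (xi 0 i).
pose z i := (w i)%:C * zeta (e p q i) i.
have hz i th : \int[mu]_x (x ^+ e p q i * gauss (a i) x * cos (2 * pi * xi 0 i * x - th)) =
    complex.Re (z i) * cos th + complex.Im (z i) * sin th.
  have := gauss_momentE th (xi 0 i) (a0 i) (e_le2 p q i).
  rewrite /gauss_moment => ->; rewrite /z /zeta -/(w i).
  case: (e p q i) => [|[|k]] /=; ring.
under eq_fun do rewrite coord2_gaussnE.
rewrite (fourier_prodf (fun i => integrable_monom_gauss (e p q i) (a0 i)) hz).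
rewrite /z big_split/= -rmorph_prod /w big_split/=.
have -> : \prod_i zeta (e p q i) i =
    ((p == q)%:R / (2 * pi * a p) - xi 0 p / a p * (xi 0 q / a q))%:C.
  have [->|pq] := eqVneq p q.
    rewrite (bigD1 q)//= big1 ?mulr1 => [|i iq].
      by rewrite /zeta /e eqxx /= mul1r expr2.
    by rewrite /zeta /e (negbTE iq).
  rewrite (bigD1 p)//= (bigD1 q) 1?eq_sym//= big1 ?mulr1 => [|i /andP[ip iq]].
    have qp : q == p = false by rewrite eq_sym (negbTE pq).
    rewrite /zeta /e !eqxx (negbTE pq) qp /= mul0r sub0r.
    by apply/eqP; rewrite eq_complex /= !mul0r !mulr0 sub0r addr0 !eqxx.
  by rewrite /zeta /e (negbTE ip) (negbTE iq).
by rewrite -rmorphM /= oppr0.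
Qed.

Lemma measurable_riesz_symbol (l k : 'I_n) : measurable_fun setT (@riesz_symbol R n l k).
Proof.
apply: measurable_funN; apply: measurable_funM; last exact: measurable_dotv_inv.
by apply: measurable_funM; exact: measurable_rV_coord.
Qed.

Lemma riesz_symbol_le1 (l k : 'I_n) xi : `|riesz_symbol l k xi| <= 1.
Proof.
have le (r : 'I_n) : xi 0 r ^+ 2 <= dotv xi xi.
  rewrite /dotv (bigD1 r)//= -expr2 lerDl sumr_ge0// => i _.
  by rewrite -expr2 sqr_ge0.
have := dotv_ge0 xi; rewrite le_eqVlt => /orP[/eqP h|h].
  by rewrite /riesz_symbol -h invr0 mulr0 normrN normr0.
rewrite /riesz_symbol normrN normrM normfV (gtr0_norm h) ler_pdivrMr// mul1r normrM.
have := le l; have := le k; rewrite -(real_normK (num_real (xi 0 l))).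
rewrite -(real_normK (num_real (xi 0 k))).
(* The product of the two moduli is at most the mean of their squares, each of which is at most
   [dotv xi xi]. *)
have := sqr_ge0 (`|xi 0 l| - `|xi 0 k|); nra.
Qed.

End fourier_quadratic.

Lemma Rintegral_sum d (T : measurableType d) (R : realType)
    (mu : {measure set T -> \bar R}) (I : Type) (s : seq I) (f : I -> T -> R) :
  (forall i, mu.-integrable setT (EFin \o f i)) ->
  mu.-integrable setT (EFin \o (fun x => \sum_(i <- s) f i x)) /\
  \int[mu]_x (\sum_(i <- s) f i x) = \sum_(i <- s) \int[mu]_x f i x.
Proof.
move=> fi; elim: s => [|i s [si IH]].
  have E : (fun x : T => \sum_(i <- [::]) f i x) = cst 0.
    by apply/funext => x; rewrite big_nil.
  rewrite E big_nil; split; first exact: integrable0.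
  by rewrite /Rintegral integral0.
have E : (fun x : T => \sum_(j <- i :: s) f j x) = fun x => f i x + \sum_(j <- s) f j x.
  by apply/funext => x; rewrite big_cons.
rewrite E big_cons -IH; split; first exact: integrableD (fi i) si.
by rewrite RintegralD//; exact: fi.
Qed.

(** * The Gaussian field and the symbol of its pressure *)

Section gaussian_field.
Context {R : realType} {n : nat}.
Local Notation lam := (@lebesgue_rV R n).
Variables (a s : 'I_n -> R) (sg : 'I_n -> 'I_n).
Hypotheses (a0 : forall i, 0 < a i) (sgI : injective sg).

(** The parameters are halved so that the product of two components carries exactly [gaussn a]. *)
Definition gaussian_field (x : 'rV[R]_n) : 'rV[R]_n :=
  \row_l (s l * (x 0 (sg l) * gaussn (fun i => a i / 2) x)).

Let gaussian_fieldE l : (fun x => gaussian_field x 0 l) =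
  fun x => s l * (x 0 (sg l) * gaussn (fun i => a i / 2) x).
Proof. by apply/funext => x; rewrite mxE. Qed.

Lemma gaussian_field_schwartz : schwartz_field gaussian_field.
Proof.
move=> l; rewrite gaussian_fieldE.
apply: (@gauss_poly_schwartz _ _ (fun i => a i / 2)) => [i|]; first by rewrite divr_gt0.
by do 2 constructor; constructor.
Qed.

Lemma gaussian_field_divergence x : divergence gaussian_field x =
  (\sum_l s l * (l == sg l)%:R - pi * \sum_l s l * a l * x 0 l * x 0 (sg l)) *
  gaussn (fun i => a i / 2) x.
Proof.
rewrite mulr_sumr -sumrB mulr_suml; apply: eq_bigr => l _.
rewrite gaussian_fieldE {1}/partial.
have dg := @differentiable_gaussn R n (fun i => a i / 2).
have dxg y : differentiable (fun y : 'rV[R]_n => y 0 (sg l) * gaussn (fun i => a i / 2) y) y.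
  by apply: differentiableM => //; exact: differentiable_coord.
rewrite deriveZ; last exact: diff_derivable.
rewrite -[X in _ *: X]/(partial l _ x) partial_coordM// partial_gaussn /GRing.scale /=.
have -> : 2 * pi * (a l / 2) = pi * a l :> R by field.
by ring.
Qed.

Let W := \prod_i (Num.sqrt (a i))^-1.
Let al i := (a i)^-1.
Let Phi l k xi := s l * s k * (W * gaussn al xi *
   ((sg l == sg k)%:R / (2 * pi * a (sg l)) - xi 0 (sg l) / a (sg l) * (xi 0 (sg k) / a (sg k)))).

Let fourier_gaussian_field l k xi :
  fourier (fun y => (gaussian_field y 0 l * gaussian_field y 0 k)%:C%C) xi = (Phi l k xi)%:C%C.
Proof.
rewrite /Phi [in RHS]rmorphM /= -fourier_coord2_gaussn//.
rewrite -fourier_realZ; last exact: integrable_coord2_gaussn.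
congr fourier; apply/funext => y; congr (_%:C)%C.
have -> : gaussn a y = gaussn (fun i => a i / 2) y * gaussn (fun i => a i / 2) y.
  rewrite /gaussn /prodf -big_split/=; apply: eq_bigr => i _.
  by rewrite -gaussD -splitr.
by rewrite !mxE; ring.
Qed.

Let integrable_riesz_Phi l k :
  lam.-integrable setT (EFin \o (fun xi => riesz_symbol l k xi * Phi l k xi)).
Proof.
have al0 i : 0 < al i by rewrite invr_gt0.
have i1 := integrableR_scale (s l * s k * W * ((sg l == sg k)%:R / (2 * pi * a (sg l))))
  (integrable_gaussn al0).
have i2 := integrableR_scale (s l * s k * W / a (sg l) / a (sg k))
  (integrable_coord2_gaussn al0 (sg l) (sg k)).
apply: eq_integrable (integrableR_bounded (integrableR_sub i1 i2)
  (measurable_riesz_symbol l k) (riesz_symbol_le1 l k)) => // xi _.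
by rewrite /= /Phi; congr (_%:E); ring.
Qed.

(** All symbols and all [Phi l k] are real, so only cosines contribute to the real part, and the
    finite sums move inside the integral. *)
Let Re_pressure x : complex.Re (pressure gaussian_field x) =
  \int[lam]_xi ((\sum_l \sum_k riesz_symbol l k xi * Phi l k xi) * cos (2 * pi * dotv x xi)).
Proof.
pose f l k xi := riesz_symbol l k xi * Phi l k xi * cos (2 * pi * dotv x xi).
have fi l k : lam.-integrable setT (EFin \o f l k).
  apply: (integrableR_bounded (integrable_riesz_Phi l k) _ (fun xi => norm_cos_le1 _)).
  apply: measurable_cosine; apply: measurable_funM => //.
  by apply: measurable_dotv.
have fE l k : complex.Re (fourier_multiplier (riesz_symbol l k)
    (fun y => (gaussian_field y 0 l * gaussian_field y 0 k)%:C%C) x) = \int[lam]_xi f l k xi.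
  rewrite -Re_inv_fourier_real /fourier_multiplier; congr (complex.Re (inv_fourier _ _)).
  by apply/funext => xi; rewrite fourier_gaussian_field -rmorphM.
have fl l := Rintegral_sum (index_enum 'I_n) (fi l).
rewrite /pressure raddf_sum.
transitivity (\sum_l \int[lam]_xi (\sum_k f l k xi)).
  apply: eq_bigr => l _; rewrite raddf_sum (fl l).2.
  by apply: eq_bigr => k _; exact: fE.
rewrite -(Rintegral_sum (index_enum 'I_n) (fun l => (fl l).1)).2.
apply: eq_Rintegral => xi _; rewrite mulr_suml; apply: eq_bigr => l _.
by rewrite mulr_suml.
Qed.

(* Vanishing divergence on the Fourier side: the quartic part of the pressure
   symbol is the square of this sum. *)
Hypothesis sg0 : forall xi : 'rV[R]_n, \sum_l s l * xi 0 l * (xi 0 (sg l) / a (sg l)) = 0.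

Let b i := W * (s i ^+ 2 / (2 * pi * a (sg i))).

(** Since [sg] is injective, the Kronecker term of [Phi] survives only for [l = k], and produces
    [b]. The quartic terms factor as the square of the sum in [sg0], which is zero. *)
Let pressure_symbolE xi : \sum_l \sum_k riesz_symbol l k xi * Phi l k xi =
  - (gaussn al xi * quadratic_symbol b xi).
Proof.
pose G := gaussn al xi; pose D := (dotv xi xi)^-1.
pose u l := s l * xi 0 l * (xi 0 (sg l) / a (sg l)).
have E l : \sum_k riesz_symbol l k xi * Phi l k xi =
    - (G * D) * (b l * xi 0 l ^+ 2) + W * G * D * u l * \sum_k u k.
  rewrite mulr_sumr (bigD1 l)//= [in RHS](bigD1 l)//= addrA; congr (_ + _).
    by rewrite /riesz_symbol /Phi eqxx mulr1n /b /u /G /D; ring.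
  apply: eq_bigr => k kl; rewrite /riesz_symbol /Phi (inj_eq sgI) eq_sym (negbTE kl) mulr0n.
  by rewrite /u /G /D; ring.
under eq_bigr do rewrite E sg0 mulr0 addr0.
by rewrite -mulr_sumr /quadratic_symbol /G /D; ring.
Qed.

(** Integrability of the real part alone gives the integral of the cosine transform two values,
    [b i] and [b j]; their common factor [W / (2 * pi)] cancels. *)
Lemma pressure_gaussian_field_inL1 i j : inL1 (pressure gaussian_field) ->
  s i ^+ 2 / a (sg i) = s j ^+ 2 / a (sg j).
Proof.
move=> [pi1 _]; have p0 := pi_gt0 R.
have W0 : 0 < W by apply: prodr_gt0 => k _; rewrite invr_gt0 sqrtr_gt0.
have al0 k : 0 < al k by rewrite invr_gt0.
have b0 k : 0 <= b k.
  apply: mulr_ge0; first exact: ltW.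
  by apply: divr_ge0; [exact: sqr_ge0|rewrite ltW// !mulr_gt0].
have mean := @Rintegral_cosine_transform_quadratic_symbol R n al b al0 b0.
have Pi : lam.-integrable setT (EFin \o (fun x =>
    \int[lam]_xi (gaussn al xi * quadratic_symbol b xi * cos (2 * pi * dotv x xi)))).
  apply: eq_integrable (integrableR_scale (-1) pi1) => // x _.
  rewrite /= Re_pressure; congr (_%:E).
  have ir := integrable_gaussn_quadratic_symbol al0 b0.
  rewrite -RintegralZl//.
    by apply: eq_Rintegral => xi _; rewrite pressure_symbolE; ring.
  apply: eq_integrable (integrableR_scale (-1) (integrableR_bounded ir _
    (fun xi => norm_cos_le1 (2 * pi * dotv x xi)))) => // [xi _|].
    by rewrite /= pressure_symbolE; congr (_%:E); ring.
  apply: measurable_cosine; apply: measurable_funM => //.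
  exact: measurable_dotv.
have : b i = b j by rewrite -(mean i Pi) (mean j Pi).
have bE k : b k = W / (2 * pi) * (s k ^+ 2 / a (sg k)) by rewrite /b !invfM; ring.
by rewrite !bE => /mulfI; apply; rewrite gt_eqF// divr_gt0// mulr_gt0.
Qed.

End gaussian_field.

(** * Choice of the parameters of the field *)

Theorem proposition1p6 (R : realType) (n : nat) (hn : (2 <= n)%N) :
  exists u : 'rV[R]_n -> 'rV[R]_n,
    [/\ schwartz_field u, divergence_free u & ~ inL1 (pressure u)].
Proof.
pose i0 : 'I_n := Ordinal (ltnW hn); pose i1 : 'I_n := Ordinal hn.
(* With the two axes swapped, zero divergence requires [s_0 a_0 + s_1 a_1 = 0], which [a = (2, 1)]
   and [s = (1, -2)] satisfy; this also gives [s_0 / a_1 + s_1 / a_0 = 0], the cancellation on the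
   Fourier side. The other components of the field vanish. *)
pose a (i : 'I_n) : R := if i == i0 then 2 else 1.
pose s (i : 'I_n) : R := if i == i0 then 1 else if i == i1 then -2 else 0.
have a0 i : 0 < a i by rewrite /a; case: ifP.
have sumE (F : 'I_n -> R) : \sum_i s i * F i = F i0 - 2 * F i1.
  rewrite (bigD1 i0)//= (bigD1 i1)//= big1 => [|i /andP[/negbTE i0F /negbTE i1F]].
    by rewrite /s /= addr0 mul1r mulNr.
  by rewrite /s i0F i1F mul0r.
have sg0 := tpermL i0 i1; have sg1 := tpermR i0 i1.
exists (gaussian_field a s (tperm i0 i1)); split.
- exact: gaussian_field_schwartz.
- move=> x; rewrite gaussian_field_divergence sumE sg0 sg1 /=.
  under [X in pi * X]eq_bigr do rewrite -!mulrA.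
  by rewrite sumE sg0 sg1 /a /=; ring.
- move=> /(pressure_gaussian_field_inL1 a0 perm_inj) h.
  have : s i0 ^+ 2 / a (tperm i0 i1 i0) = s i1 ^+ 2 / a (tperm i0 i1 i1).
    apply: h => xi; under eq_bigr do rewrite -!mulrA.
    by rewrite sumE sg0 sg1 /a /=; field.
  (* The two sides are [1 / 1] and [4 / 2]. *)
  by rewrite sg0 sg1 /a /s /=; lra.
Qed.
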